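(* Let $\mathcal{H}$ be a complex infinite-dimensional Hilbert space, let $n>1$ be an integer, and let $A\in B(\mathcal{H})$ satisfy $A^*A^n=A^nA^*$ (equivalently, $A^n$ is normal). Then both $A$ and $A^*$ satisfy property $(\beta)_\epsilon$.
   Context: For an open set $\mathcal{U}\subseteq\mathbb{C}$, $\mathcal{E}(\mathcal{U},\mathcal{H})$ is the Fréchet space of infinitely differentiable $\mathcal{H}$-valued functions on $\mathcal{U}$ with the topology of uniform convergence of all derivatives on compact subsets of $\mathcal{U}$. An operator $S\in B(\mathcal{H})$ satisfies property $(\beta)_\epsilon$ at $\lambda\in\mathbb{C}$ if there is a neighborhood $\mathcal{N}$ of $\lambda$ such that for every open $\mathcal{U}\subseteq\mathcal{N}$ and every sequence $(f_k)$ in $\mathcal{E}(\mathcal{U},\mathcal{H})$, $(S-z)f_k(z)\to0$ in $\mathcal{E}(\mathcal{U},\mathcal{H})$ implies $f_k\to0$ in $\mathcal{E}(\mathcal{U},\mathcal{H})$; $S$ satisfies $(\beta)_\epsilon$ if it does so at every $\lambda\in\mathbb{C}$. *)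

(* Defs.v *)
From HB Require Import structures.
From mathcomp Require Import all_boot all_order all_algebra sesquilinear.
From mathcomp Require Import complex.
From mathcomp Require Import all_classical all_reals topology normedtype.
Import Order.TTheory GRing.Theory Num.Theory numFieldNormedType.Exports.

Set Implicit Arguments.
Unset Strict Implicit.
Unset Printing Implicit Defensive.

Local Open Scope ring_scope.
Local Open Scope classical_set_scope.

Definition C (R : realType) : numClosedFieldType := R[i].

Section Defs.
Variables (R : realType) (H : lmodType (C R)) (ip : {dot H for Num.conj}).

(* Norm induced by the inner product ip (linear in the first variable,
   conjugate-linear in the second, positive definite). *)
Definition hnorm (x : H) : R := Num.sqrt (@complex.Re R (ip x x)).

Definition ip_complete : Prop :=
  forall u : nat -> H,
    (forall e : R, 0 < e -> exists N : nat, forall m k : nat,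
        (N <= m)%N -> (N <= k)%N -> hnorm (u m - u k) < e) ->
    exists l : H, forall e : R, 0 < e -> exists N : nat, forall k : nat,
        (N <= k)%N -> hnorm (u k - l) < e.

Definition bounded_op (A : H -> H) : Prop :=
  exists M : R, forall x : H, hnorm (A x) <= M * hnorm x.

Definition is_adjoint (A B : H -> H) : Prop :=
  forall x y : H, ip (A x) y = ip x (B y).

(* Real directions 1 (d/dx) and 'i (d/dy) in C = R^2. *)
Definition dir (b : bool) : C R := if b then ('i)%C else 1.

Definition pderiv_at (f : C R -> H) (d z : C R) (v : H) : Prop :=
  forall e : R, 0 < e -> \forall t \near (0 : R)^',
    hnorm (((t%:C)%C : C R)^-1 *: (f (z + (t%:C)%C * d) - f z) - v) <= e.

(* g is the family of all iterated partial derivatives of f on U: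
   g [::] = f, g (b :: s) = partial_b (g s), and all of them continuous on U.
   Thus f is C^infinity on U iff such a family exists. *)
Definition deriv_family (U : set (C R)) (f : C R -> H)
    (g : seq bool -> C R -> H) : Prop :=
  [/\ forall z, U z -> g [::] z = f z,
      forall s b z, U z -> pderiv_at (g s) (dir b) z (g (b :: s) z) &
      forall s z, U z -> forall e : R, 0 < e ->
        \forall w \near z, hnorm (g s w - g s z) <= e].

Definition smooth_on (U : set (C R)) (f : C R -> H) : Prop :=
  exists g, deriv_family U f g.

(* F k --> 0 in the Frechet space E(U, H): every derivative converges to 0
   uniformly on every compact subset of U. *)
Definition E_cvg0 (U : set (C R)) (F : nat -> C R -> H) : Prop :=
  forall G : nat -> seq bool -> C R -> H,
    (forall k, deriv_family U (F k) (G k)) ->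
    forall (s : seq bool) (K : set (C R)), compact K -> K `<=` U ->
    forall e : R, 0 < e -> exists N : nat, forall k : nat, (N <= k)%N ->
      forall z, K z -> hnorm (G k s z) <= e.

Definition beta_eps_at (S : H -> H) (lam : C R) : Prop :=
  exists N : set (C R), nbhs lam N /\
    forall U : set (C R), open U -> U `<=` N ->
    forall F : nat -> C R -> H, (forall k, smooth_on U (F k)) ->
      E_cvg0 U (fun k z => S (F k z) - z *: F k z) -> E_cvg0 U F.

Definition beta_eps (S : H -> H) : Prop := forall lam : C R, beta_eps_at S lam.

End Defs.

Definition infinite_dim (R : realType) (H : lmodType (C R)) : Prop :=
  forall m : nat, exists v : 'I_m -> H, forall c : 'I_m -> C R,
    \sum_(i < m) c i *: v i = 0 -> forall i, c i = 0.

(* Main.v *)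
(* Let [N = A^n], a normal operator, let [T = N - z^n], whose pointwise adjoint is
   [T' = N^* - conj z ^ n], and write [u_l] for the [l]-th d-bar derivative of a smooth [u].
   As [z^n] is holomorphic, [(T u)_l = T u_l], and normality gives [|T' u_l| = |T u_l|]. The
   [n]-fold commutator of d-bar with [T'] is the nonzero scalar [- n!], so, in the weak sense,
   [u] is a combination of d-bar derivatives of order at most [n] of the functions [T' u_l].
   Pairing with the kernel [conj z ^ j / (|z|^2 + eta)], [j = n + 2], and a polynomial cutoff of a
   square, and letting [eta] tend to [0], one gets
     [|u z| <= D * sup_{l <= 2 n + 2} |(T u)_l|],
   the supremum being over the square around [z] and [D] depending only on [n] and on the square.
   Thus if the d-bar derivatives of [(A - z) u_k] all tend to [0] locally uniformly, so do those
   of [u_k]. For the other derivatives use induction on the word [s] of partial derivatives: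
   [(A - z) D_s f] is [D_s ((A - z) f)] plus derivatives of [f] along shorter words. *)

Require Import Defs.
From HB Require Import structures.
From mathcomp Require Import all_boot all_order all_algebra sesquilinear.
From mathcomp Require Import complex.
From mathcomp Require Import all_classical all_reals topology normedtype.
From mathcomp Require Import ereal sequences derive realfun measure lebesgue_measure lebesgue_integral ftc.
From mathcomp Require Import ring lra zify.
Import Order.TTheory GRing.Theory Num.Theory numFieldNormedType.Exports.
Local Open Scope ring_scope.

Set Implicit Arguments.
Unset Strict Implicit.
Unset Printing Implicit Defensive.

(** * Integration over squares *)

(** [n! u] is a sum of d-bar derivatives of the functions [T' u_l], and only these functions, not
    their derivatives, are under control; hence up to [n] derivatives have to be moved onto the
    kernel. Near the origin the [i]-th d-bar derivative of [conj z ^ j / |z|^2] has size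
    [|z| ^ (j - 2 - i)]: with [j = n + 2] all orders [i <= n] are bounded, while the derivative of
    order [j] is a multiple of the delta function. The parameter [eta > 0] removes the singularity,
    so that only continuous functions are integrated, and the bounds for [i <= n] do not depend on
    it. The number [2 n + 2] is a count: trading the [n + 2] derivatives of the kernel puts up to
    [n + 2] of them on [u], and undoing [n] commutators up to [n] more. All integrals are scalar:
    functions are paired with the fixed vector [- u z], and positivity of the top derivative of the
    kernel turns a bound on an integral into a bound on [|u z|^2], which is then divided by
    [|u z|]. *)

Section PlaneIntegral.
Variable R : realType.
Local Open Scope classical_set_scope.
Implicit Types (f g h : R -> R -> R) (rho r : R).

(** Regularity is asked on an open square and integrals are taken over closed squares with
    [r < rho], so two-sided limits and derivatives are available up to the boundary of the domain of
    integration. *)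
Definition continuous_on_square rho f := forall a b : R,
  `|a| < rho -> `|b| < rho -> {for (a, b), continuous (fun p : R * R => f p.1 p.2)}.

Lemma continuous_on_square_l rho f a b : continuous_on_square rho f ->
  `|a| < rho -> `|b| < rho -> {for a, continuous (f ^~ b)}.
Proof.
move=> cf a_lt b_lt.
apply: (@continuous_comp R (R * R)%type R (fun x => (x, b)) (fun p => f p.1 p.2)).
  by apply: (@cvg_pair _ _ _ _ (nbhs a) (nbhs b)); [exact: cvg_id|exact: cvg_cst].
exact: cf.
Qed.

Lemma continuous_on_square_r rho f a b : continuous_on_square rho f ->
  `|a| < rho -> `|b| < rho -> {for b, continuous (f a)}.
Proof.
move=> cf a_lt b_lt.
apply: (@continuous_comp R (R * R)%type R (fun x => (a, x)) (fun p => f p.1 p.2)).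
  by apply: (@cvg_pair _ _ _ _ (nbhs a) (nbhs b)); [exact: cvg_cst|exact: cvg_id].
exact: cf.
Qed.

Lemma in_segmentN r (x : R) : x \in `[- r, r]%R = (`|x| <= r).
Proof. by rewrite in_itv/= ler_norml. Qed.

Lemma continuous_on_square_bounded rho r f : continuous_on_square rho f -> r < rho ->
  exists2 M, 0 <= M & forall a b, `|a| <= r -> `|b| <= r -> `|f a b| <= M.
Proof.
move=> cf r_lt.
pose K := (`[- r, r]%classic `*` `[- r, r]%classic : set (R * R)).
have cK : compact K by apply: compact_setX; exact: segment_compact.
have cfK : {within K, continuous (fun p : R * R => f p.1 p.2)}.
  apply: continuous_in_subspaceT => -[a b] /set_mem[/=].
  rewrite !in_segmentN => ar br.
  by apply: cf; apply: le_lt_trans r_lt.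
have /compact_bounded[M [_ HM]] := continuous_compact cfK cK.
exists (`|M| + 1); first by rewrite addr_ge0.
move=> a b ar br; apply: (HM (`|M| + 1)); first by rewrite ltr_pwDr ?ltr01 ?ler_norm.
by exists (a, b) => //=; split => /=; rewrite in_segmentN.
Qed.

Local Notation mu := (@lebesgue_measure R).
Local Notation seg r := (`[(- r)%R, r%R]%classic : set R).

Lemma integrable_segment rho r (u : R -> R) : r < rho ->
  (forall x : R, `|x| < rho -> {for x, continuous u}) ->
  mu.-integrable (seg r) (EFin \o u).
Proof.
move=> r_lt cu; apply: continuous_compact_integrable; first exact: segment_compact.
apply: continuous_in_subspaceT => x /set_mem /=; rewrite in_segmentN => xr.
by apply: cu; exact: le_lt_trans r_lt.
Qed.

(** An iterated integral whose order is never exchanged: derivatives in the outer variable are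
    treated by differentiation under the integral sign. *)
Definition plane_integral r f : R :=
  \int[mu]_(a in seg r) (\int[mu]_(b in seg r) f a b).

Lemma integrable_inner rho r f a : r < rho -> continuous_on_square rho f ->
  `|a| < rho -> mu.-integrable (seg r) (EFin \o f a).
Proof.
move=> r_lt cf a_lt; apply: (integrable_segment r_lt) => b b_lt.
exact: continuous_on_square_r cf _ _.
Qed.

Lemma continuous_inner rho r f : r < rho -> continuous_on_square rho f ->
  forall a, `|a| < rho -> {for a, continuous (fun a => \int[mu]_(b in seg r) f a b)}.
Proof.
move=> r_lt cf a a_lt.
(* The closed square of half-side [s] contains both the segment of integration and a neighbourhood
   of [a]; the bound of [f] on it is the dominating constant. *)
pose s := (Num.max r `|a| + rho) / 2.
have m_lt : Num.max r `|a| < rho by rewrite gt_max r_lt a_lt.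
have s_lt : s < rho by rewrite /s; lra.
have [ms_r ms_a] : r < s /\ `|a| < s.
  have : Num.max r `|a| < s by rewrite /s; lra.
  by rewrite gt_max => /andP[].
have [M M0 HM] := continuous_on_square_bounded cf s_lt.
have Is x : (`]- s, s[%classic : set R) x -> `|x| < s.
  by rewrite /= in_itv/= ltr_norml.
apply: (@continuity_under_integral _ _ _ mu f (seg r) _ (- s) s _ _ (fun=> M)).
- exact: measurable_itv.
- by move=> x /Is xs; apply: (integrable_inner r_lt cf); exact: lt_trans s_lt.
- apply: aeW => y; rewrite /= in_segmentN => yr x /set_mem/Is xs.
  by apply: continuous_on_square_l cf _ _; [exact: lt_trans s_lt|exact: le_lt_trans r_lt].
- apply: (@integrable_segment _ _ (fun=> M) r_lt) => x _; exact: cvg_cst.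
- move=> x /Is xs; apply: aeW => y; rewrite /= in_segmentN => yr.
  by apply: HM; [exact: ltW|apply: le_trans (ltW ms_r)].
- by apply/mem_set; rewrite /= in_itv/= -ltr_norml.
Qed.

Lemma integrable_outer rho r f : r < rho -> continuous_on_square rho f ->
  mu.-integrable (seg r) (EFin \o (fun a => \int[mu]_(b in seg r) f a b)).
Proof.
by move=> r_lt cf; apply: (integrable_segment r_lt); exact: continuous_inner.
Qed.

Let seg_lt rho r (x : R) : r < rho -> seg r x -> `|x| < rho.
Proof. by move=> r_lt /=; rewrite in_segmentN => /le_lt_trans; apply. Qed.

Lemma plane_integralD rho r f g : r < rho ->
  continuous_on_square rho f -> continuous_on_square rho g ->
  plane_integral r (fun a b => f a b + g a b) = plane_integral r f + plane_integral r g.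
Proof.
move=> r_lt cf cg; rewrite /plane_integral -RintegralD//.
- apply: eq_Rintegral => a /set_mem /(seg_lt r_lt) a_lt.
  by rewrite RintegralD//; apply: integrable_inner r_lt _ _.
- exact: integrable_outer r_lt cf.
- exact: integrable_outer r_lt cg.
Qed.

Lemma plane_integralZ rho r f (k : R) : r < rho -> continuous_on_square rho f ->
  plane_integral r (fun a b => k * f a b) = k * plane_integral r f.
Proof.
move=> r_lt cf; rewrite /plane_integral -RintegralZl//.
- apply: eq_Rintegral => a /set_mem /(seg_lt r_lt) a_lt.
  by rewrite RintegralZl//; apply: integrable_inner r_lt _ _.
- exact: integrable_outer r_lt cf.
Qed.

Lemma eq_plane_integral r f g : (forall a b, `|a| <= r -> `|b| <= r -> f a b = g a b) ->
  plane_integral r f = plane_integral r g.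
Proof.
move=> fg; rewrite /plane_integral.
apply: eq_Rintegral => a /set_mem/=; rewrite in_segmentN => ar.
by apply: eq_Rintegral => b /set_mem/=; rewrite in_segmentN => br; exact: fg.
Qed.

Lemma le_plane_integral rho r f g : r < rho ->
  continuous_on_square rho f -> continuous_on_square rho g ->
  (forall a b, `|a| <= r -> `|b| <= r -> f a b <= g a b) ->
  plane_integral r f <= plane_integral r g.
Proof.
move=> r_lt cf cg fg; rewrite /plane_integral.
apply: le_Rintegral => //.
- exact: integrable_outer r_lt cf.
- exact: integrable_outer r_lt cg.
move=> a /[dup] /(seg_lt r_lt) a_lt /=; rewrite in_segmentN => ar.
apply: le_Rintegral => //; [exact: integrable_inner r_lt _ _..|].
by move=> b /=; rewrite in_segmentN => br; exact: fg.
Qed.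

Lemma continuous_on_square_cst rho (k : R) : continuous_on_square rho (fun=> fun=> k).
Proof. by move=> a b _ _; exact: cvg_cst. Qed.

Lemma plane_integral_cst r (k : R) : 0 <= r ->
  plane_integral r (fun=> fun=> k) = 4 * r ^+ 2 * k.
Proof.
move=> r0; rewrite /plane_integral.
have fm : fine (mu (seg r)) = 2 * r.
  rewrite lebesgue_measure_itv/= lte_fin.
  case: ltP => h/=; lra.
have -> : (fun a : R => \int[mu]_(b in seg r) k) = (fun=> k * (2 * r)).
  by apply/funext => a; rewrite Rintegral_cst ?fm.
by rewrite Rintegral_cst ?fm//; ring.
Qed.

Lemma plane_integral_bound rho r f M : 0 <= r -> r < rho -> continuous_on_square rho f ->
  (forall a b, `|a| <= r -> `|b| <= r -> `|f a b| <= M) ->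
  `|plane_integral r f| <= 4 * r ^+ 2 * M.
Proof.
move=> r0 r_lt cf fM.
rewrite ler_norml -mulrN -!plane_integral_cst//.
by apply/andP; split; apply: (le_plane_integral r_lt) => //;
  do ?[exact: continuous_on_square_cst]; move=> a b ar br;
  have := fM a b ar br; rewrite ler_norml => /andP[].
Qed.

Lemma segment_FTC2 rho r (u v : R -> R) : 0 < r -> r < rho ->
  (forall x : R, `|x| < rho -> is_derive x 1 u (v x)) ->
  (forall x : R, `|x| < rho -> {for x, continuous v}) ->
  \int[mu]_(x in seg r) v x = u r - u (- r).
Proof.
move=> r0 r_lt du cv.
have cu x : `|x| < rho -> {for x, continuous u}.
  move=> x_lt; apply: differentiable_continuous; apply/derivable1_diffP.
  by have [] := du x x_lt.
have rr : `|r| < rho by rewrite gtr0_norm.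
have rNr : `|- r| < rho by rewrite normrN gtr0_norm.
rewrite /Rintegral (@continuous_FTC2 _ v u); first by [].
- lra.
- apply: continuous_in_subspaceT => x /set_mem /=; rewrite in_segmentN => xr.
  by apply: cv; exact: le_lt_trans r_lt.
- split.
  + move=> x; rewrite in_itv/= -ltr_norml => xr.
    by have [] := du x (lt_trans xr r_lt).
  + by apply: cvg_at_right_filter; exact: cu.
  + by apply: cvg_at_left_filter; exact: cu.
- move=> x; rewrite in_itv/= -ltr_norml => xr.
  by rewrite derive1E; have [_] := du x (lt_trans xr r_lt).
Qed.

Definition C1_on_square rho f fx fy :=
  [/\ continuous_on_square rho f, continuous_on_square rho fx, continuous_on_square rho fy,
    (forall a b : R, `|a| < rho -> `|b| < rho -> is_derive a 1 (f ^~ b) (fx a b)) &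
    (forall a b : R, `|a| < rho -> `|b| < rho -> is_derive b 1 (f a) (fy a b))].

Lemma plane_integral_dy rho r f fx fy : 0 < r -> r < rho -> C1_on_square rho f fx fy ->
  (forall a, `|a| <= r -> f a r = 0 /\ f a (- r) = 0) -> plane_integral r fy = 0.
Proof.
move=> r0 r_lt [cf _ cfy _ dfy] f0; rewrite /plane_integral.
rewrite (_ : 0 = \int[mu]_(a in seg r) 0); last first.
  by rewrite Rintegral_cst ?mul0r.
apply: eq_Rintegral => a /set_mem/= /[dup] /(seg_lt r_lt) a_lt.
rewrite in_segmentN => ar.
rewrite (segment_FTC2 r0 r_lt (fun b => dfy a b a_lt)).
  by have [-> ->] := f0 a ar; rewrite subrr.
by move=> b b_lt; exact: continuous_on_square_r cfy _ _.
Qed.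

(** The inner integral [F a] of [f a] has the inner integral of [fx a] as derivative, by domination
    on a slightly larger square; then the fundamental theorem applies to [F], which vanishes at both
    ends. *)
Lemma plane_integral_dx rho r f fx fy : 0 < r -> r < rho -> C1_on_square rho f fx fy ->
  (forall b, `|b| <= r -> f r b = 0 /\ f (- r) b = 0) -> plane_integral r fx = 0.
Proof.
move=> r0 r_lt [cf cfx _ dfx _] f0; rewrite /plane_integral.
pose F a := \int[mu]_(b in seg r) f a b.
have F0 a : (forall b, `|b| <= r -> f a b = 0) -> F a = 0.
  move=> fa0; rewrite /F (_ : 0 = \int[mu]_(a in seg r) 0); last first.
    by rewrite Rintegral_cst ?mul0r.
  by apply: eq_Rintegral => b /set_mem/=; rewrite in_segmentN => br; exact: fa0.
have dF (a : R) : `|a| < rho -> is_derive a 1 F (\int[mu]_(b in seg r) fx a b).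
  move=> a_lt.
  pose s := (Num.max r `|a| + rho) / 2.
  have m_lt : Num.max r `|a| < rho by rewrite gt_max r_lt a_lt.
  have s_lt : s < rho by rewrite /s; lra.
  have [ms_r ms_a] : r < s /\ `|a| < s.
    have : Num.max r `|a| < s by rewrite /s; lra.
    by rewrite gt_max => /andP[].
  have [M M0 HM] := continuous_on_square_bounded cfx s_lt.
  have Is x : (`]- s, s[%classic : set R) x -> `|x| < s.
    by rewrite /= in_itv/= ltr_norml.
  have Ia : (`]- s, s[%classic : set R) a by rewrite /= in_itv/= -ltr_norml.
  have d1 x y : `|x| < rho -> seg r y -> partial1of2 f x y = fx x y.
    move=> x_lt /(seg_lt r_lt) y_lt; rewrite partial1of2E.
    by have [_] := dfx x y x_lt y_lt.
  have H1 x : (`]- s, s[%classic : set R) x -> mu.-integrable (seg r) (EFin \o f x).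
    by move=> /Is xs; apply: (integrable_inner r_lt cf); exact: lt_trans s_lt.
  have H2 x y : (`]- s, s[%classic : set R) x -> seg r y -> derivable (f ^~ y) x 1.
    by move=> /Is xs /(seg_lt r_lt) y_lt; have [] := dfx x y (lt_trans xs s_lt) y_lt.
  have H3 : mu.-integrable (seg r) (EFin \o (fun=> M)).
    by apply: (@integrable_segment _ _ (fun=> M) r_lt) => x _; exact: cvg_cst.
  have H4 x y : (`]- s, s[%classic : set R) x -> seg r y -> `|partial1of2 f x y| <= M.
    move=> /Is xs yr; rewrite d1//; last exact: lt_trans s_lt.
    apply: HM; [exact: ltW|].
    by move: yr => /=; rewrite in_segmentN => /le_trans; apply; exact: ltW.
  have -> : \int[mu]_(b in seg r) fx a b = F^`() a.
    rewrite /F (@differentiation_under_integral _ _ _ mu f (seg r) (measurable_itv _) _ _ _ Ia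
      H1 H2 (fun=> M) (fun=> M0) H3 H4).
    by apply: eq_Rintegral => b /set_mem br; rewrite d1.
  rewrite derive1E; apply: DeriveDef => //.
  exact: (@derivable_under_integral _ _ _ mu f (seg r) (measurable_itv _) _ _ _ Ia
    H1 H2 (fun=> M) (fun=> M0) H3 H4).
rewrite (segment_FTC2 r0 r_lt dF).
  by rewrite !F0 ?subrr// => b br; have [] := f0 b br.
by move=> a a_lt; exact: (continuous_inner r_lt cfx).
Qed.

End PlaneIntegral.

(** * The d-bar operator on scalar functions *)

Section Dbar.
Variable R : realType.
Local Open Scope classical_set_scope.
Local Open Scope complex_scope.
Implicit Types (rho r : R).

(** * Calculus of real C1 functions on a square *)

Section RealC1.
Variable rho : R.
Implicit Types f g : R -> R -> R.

Lemma continuous_on_squareD f g :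
  continuous_on_square rho f -> continuous_on_square rho g ->
  continuous_on_square rho (fun a b => f a b + g a b).
Proof. by move=> cf cg a b ha hb; apply: cvgD; [exact: cf|exact: cg]. Qed.

Lemma continuous_on_squareM f g :
  continuous_on_square rho f -> continuous_on_square rho g ->
  continuous_on_square rho (fun a b => f a b * g a b).
Proof. by move=> cf cg a b ha hb; apply: cvgM; [exact: cf|exact: cg]. Qed.

Lemma continuous_on_squareN f :
  continuous_on_square rho f -> continuous_on_square rho (fun a b => - f a b).
Proof. by move=> cf a b ha hb; apply: cvgN; exact: cf. Qed.

Lemma continuous_on_squareV f : (forall a b, f a b != 0) ->
  continuous_on_square rho f -> continuous_on_square rho (fun a b => (f a b)^-1).
Proof. by move=> f0 cf a b ha hb; apply: cvgV; [exact: f0|exact: cf]. Qed.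

Lemma continuous_on_square_fst (u : R -> R) : continuous u ->
  continuous_on_square rho (fun a _ => u a).
Proof.
move=> cu a b _ _.
by apply: (@continuous_comp (R * R)%type R R fst u); [exact: cvg_fst|exact: cu].
Qed.

Lemma continuous_on_square_snd (u : R -> R) : continuous u ->
  continuous_on_square rho (fun _ b => u b).
Proof.
move=> cu a b _ _.
by apply: (@continuous_comp (R * R)%type R R snd u); [exact: cvg_snd|exact: cu].
Qed.

Lemma C1_on_squareD f fx fy g gx gy :
  C1_on_square rho f fx fy -> C1_on_square rho g gx gy ->
  C1_on_square rho (fun a b => f a b + g a b) (fun a b => fx a b + gx a b)
    (fun a b => fy a b + gy a b).
Proof.
move=> [cf cfx cfy dfx dfy] [cg cgx cgy dgx dgy].
split; [exact: continuous_on_squareD..| |] => a b ha hb.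
- exact: is_deriveD (dfx a b ha hb) (dgx a b ha hb).
- exact: is_deriveD (dfy a b ha hb) (dgy a b ha hb).
Qed.

Lemma C1_on_squareM f fx fy g gx gy :
  C1_on_square rho f fx fy -> C1_on_square rho g gx gy ->
  C1_on_square rho (fun a b => f a b * g a b)
    (fun a b => fx a b * g a b + f a b * gx a b)
    (fun a b => fy a b * g a b + f a b * gy a b).
Proof.
move=> [cf cfx cfy dfx dfy] [cg cgx cgy dgx dgy].
split; do ?[apply: continuous_on_squareD]; do ?[exact: continuous_on_squareM];
  move=> a b ha hb.
- apply: is_derive_eq; first exact: is_deriveM (dfx a b ha hb) (dgx a b ha hb).
  by rewrite /GRing.scale/=; ring.
- apply: is_derive_eq; first exact: is_deriveM (dfy a b ha hb) (dgy a b ha hb).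
  by rewrite /GRing.scale/=; ring.
Qed.

Lemma C1_on_squareN f fx fy : C1_on_square rho f fx fy ->
  C1_on_square rho (fun a b => - f a b) (fun a b => - fx a b) (fun a b => - fy a b).
Proof.
move=> [cf cfx cfy dfx dfy].
split; [exact: continuous_on_squareN..| |] => a b ha hb.
- exact: is_deriveN (dfx a b ha hb).
- exact: is_deriveN (dfy a b ha hb).
Qed.

Lemma C1_on_squareV f fx fy : (forall a b, f a b != 0) -> C1_on_square rho f fx fy ->
  C1_on_square rho (fun a b => (f a b)^-1) (fun a b => - ((f a b)^-1 ^+ 2 * fx a b))
    (fun a b => - ((f a b)^-1 ^+ 2 * fy a b)).
Proof.
move=> f0 [cf cfx cfy dfx dfy].
have cV := continuous_on_squareV f0 cf.
have cV2 : continuous_on_square rho (fun a b => (f a b)^-1 ^+ 2).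
  exact: continuous_on_squareM.
split; do ?[apply: continuous_on_squareN]; do ?[exact: continuous_on_squareM]; first by [].
  move=> a b ha hb; apply: is_derive_eq.
    exact: is_deriveV (f0 a b) (dfx a b ha hb).
  by rewrite /GRing.scale/= -exprVn mulNr.
move=> a b ha hb; apply: is_derive_eq.
  exact: is_deriveV (f0 a b) (dfy a b ha hb).
by rewrite /GRing.scale/= -exprVn mulNr.
Qed.

Lemma C1_on_square_cst (k : R) :
  C1_on_square rho (fun _ _ => k) (fun _ _ => 0) (fun _ _ => 0).
Proof.
by split; try exact: continuous_on_square_cst; move=> a b _ _; exact: is_derive_cst.
Qed.

(** With formal derivatives, this covers both the coordinate functions and the cutoff. *)
Lemma C1_on_square_poly (p q : {poly R}) :
  C1_on_square rho (fun a b => p.[a] * q.[b]) (fun a b => p^`().[a] * q.[b])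
    (fun a b => p.[a] * q^`().[b]).
Proof.
have cp (s : {poly R}) : continuous_on_square rho (fun a _ => s.[a]).
  by apply: continuous_on_square_fst; exact: continuous_horner.
have cq (s : {poly R}) : continuous_on_square rho (fun _ b => s.[b]).
  by apply: continuous_on_square_snd; exact: continuous_horner.
split; [exact: continuous_on_squareM..| |] => a b _ _.
  by apply: is_derive_eq; rewrite /GRing.scale/=; ring.
by apply: is_derive_eq; rewrite /GRing.scale/=; ring.
Qed.

Lemma C1_on_square_fst : C1_on_square rho (fun a _ => a) (fun _ _ => 1) (fun _ _ => 0).
Proof.
have := C1_on_square_poly 'X 1.
by under eq_fun do under eq_fun do rewrite hornerX hornerC mulr1;
  under [X in C1_on_square _ _ X _]eq_fun do under eq_fun do rewrite derivX !hornerC mulr1;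
  under [X in C1_on_square _ _ _ X]eq_fun do under eq_fun do rewrite derivC hornerC mulr0.
Qed.

Lemma C1_on_square_snd : C1_on_square rho (fun _ b => b) (fun _ _ => 0) (fun _ _ => 1).
Proof.
have := C1_on_square_poly 1 'X.
by under eq_fun do under eq_fun do rewrite hornerX hornerC mul1r;
  under [X in C1_on_square _ _ X _]eq_fun do under eq_fun do rewrite derivC !hornerC mul0r;
  under [X in C1_on_square _ _ _ X]eq_fun do under eq_fun do rewrite derivX !hornerC mulr1.
Qed.

End RealC1.

Local Notation Re := complex.Re.
Local Notation Im := complex.Im.
Implicit Types f g : R -> R -> R[i].

(** The Wirtinger derivative [(d/dx + i d/dy) / 2], as a relation that constrains [g] on the open
    square only. Splitting into real and imaginary parts reduces everything to derivatives of real
    functions of one real variable. *)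
Definition has_dbar rho f g : Prop := exists fx fy : R -> R -> R[i],
  [/\ C1_on_square rho (fun a b => Re (f a b)) (fun a b => Re (fx a b)) (fun a b => Re (fy a b)),
      C1_on_square rho (fun a b => Im (f a b)) (fun a b => Im (fx a b)) (fun a b => Im (fy a b)) &
      forall a b, `|a| < rho -> `|b| < rho ->
        g a b = 2^-1 * (fx a b + 'i%C * fy a b)].

Lemma complex_ReD (x y : R[i]) : Re (x + y) = Re x + Re y. Proof. by case: x y => [? ?] []. Qed.
Lemma complex_ImD (x y : R[i]) : Im (x + y) = Im x + Im y. Proof. by case: x y => [? ?] []. Qed.
Lemma complex_ReM (x y : R[i]) : Re (x * y) = Re x * Re y + - (Im x * Im y).
Proof. by case: x y => [? ?] []. Qed.
Lemma complex_ImM (x y : R[i]) : Im (x * y) = Re x * Im y + Im x * Re y.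
Proof. by case: x y => [? ?] []. Qed.

Lemma has_dbarD rho f f' g g' : has_dbar rho f f' -> has_dbar rho g g' ->
  has_dbar rho (fun a b => f a b + g a b) (fun a b => f' a b + g' a b).
Proof.
move=> [fx [fy [rf imf fE]]] [gx [gy [rg img gE]]].
exists (fun a b => fx a b + gx a b), (fun a b => fy a b + gy a b); split.
- have := C1_on_squareD rf rg.
  by congr C1_on_square; apply/funext => a; apply/funext => b; rewrite complex_ReD.
- have := C1_on_squareD imf img.
  by congr C1_on_square; apply/funext => a; apply/funext => b; rewrite complex_ImD.
- by move=> a b ha hb; rewrite fE// gE//; ring.
Qed.

Lemma has_dbarM rho f f' g g' : has_dbar rho f f' -> has_dbar rho g g' ->
  has_dbar rho (fun a b => f a b * g a b) (fun a b => f' a b * g a b + f a b * g' a b).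
Proof.
move=> [fx [fy [rf imf fE]]] [gx [gy [rg img gE]]].
exists (fun a b => fx a b * g a b + f a b * gx a b),
  (fun a b => fy a b * g a b + f a b * gy a b); split.
- have := C1_on_squareD (C1_on_squareM rf rg) (C1_on_squareN (C1_on_squareM imf img)).
  by congr C1_on_square; apply/funext => a; apply/funext => b; rewrite ?complex_ReD !complex_ReM; ring.
- have := C1_on_squareD (C1_on_squareM rf img) (C1_on_squareM imf rg).
  by congr C1_on_square; apply/funext => a; apply/funext => b; rewrite ?complex_ImD !complex_ImM; ring.
- by move=> a b ha hb; rewrite fE// gE//; ring.
Qed.

Lemma has_dbar_cst rho (k : R[i]) : has_dbar rho (fun _ _ => k) (fun _ _ => 0).
Proof.
exists (fun _ _ => 0), (fun _ _ => 0); split; [exact: C1_on_square_cst..|].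
by move=> *; ring.
Qed.

Lemma has_dbar_eq rho f g g' : has_dbar rho f g ->
  (forall a b, `|a| < rho -> `|b| < rho -> g a b = g' a b) -> has_dbar rho f g'.
Proof.
move=> [fx [fy [rf imf fE]]] gg'; exists fx, fy; split => // a b ha hb.
by rewrite -gg'// fE.
Qed.

Lemma has_dbarX rho f f' k : has_dbar rho f f' ->
  has_dbar rho (fun a b => f a b ^+ k) (fun a b => k%:R * f a b ^+ k.-1 * f' a b).
Proof.
move=> df; elim: k => [|k IH].
  apply: (has_dbar_eq (has_dbar_cst rho 1)) => a b _ _; by rewrite !mul0r.
under eq_fun do under eq_fun do rewrite exprS.
apply: (has_dbar_eq (has_dbarM df IH)) => a b _ _ /=.
case: k {IH} => [|k] /=; first by rewrite expr0; ring.
by rewrite exprS (natrD _ 1 k.+1); ring.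
Qed.

Lemma has_dbar_sum rho (I : Type) (s : seq I) (P : pred I) (F G : I -> R -> R -> R[i]) :
  (forall i, P i -> has_dbar rho (F i) (G i)) ->
  has_dbar rho (fun a b => \sum_(i <- s | P i) F i a b) (fun a b => \sum_(i <- s | P i) G i a b).
Proof.
move=> dF; elim: s => [|i s IH].
  have := has_dbar_cst rho 0.
  by congr has_dbar; apply/funext => a; apply/funext => b; rewrite big_nil.
case Pi : (P i); last first.
  move: IH; congr has_dbar; apply/funext => a; apply/funext => b.
    by rewrite [RHS]big_cons Pi.
  by rewrite [RHS]big_cons Pi.
have := has_dbarD (dF i Pi) IH; congr has_dbar; apply/funext => a; apply/funext => b.
  by rewrite [RHS]big_cons Pi.
by rewrite [RHS]big_cons Pi.
Qed.

Lemma has_dbar_real rho (u ux uy : R -> R -> R) : C1_on_square rho u ux uy ->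
  has_dbar rho (fun a b => (u a b)%:C) (fun a b => 2^-1 * ((ux a b)%:C + 'i%C * (uy a b)%:C)).
Proof.
move=> du; exists (fun a b => (ux a b)%:C), (fun a b => (uy a b)%:C); split => //.
exact: C1_on_square_cst.
Qed.

Lemma has_dbar_conj rho : has_dbar rho (fun a b => a -i* b) (fun _ _ => 1).
Proof.
exists (fun _ _ => 1), (fun _ _ => - 'i%C); split => /=.
- by rewrite oppr0; exact: C1_on_square_fst.
- by have := C1_on_squareN (C1_on_square_snd rho); rewrite oppr0.
- move=> a b _ _; rewrite mulrN -expr2 sqr_i opprK.
  by field.
Qed.

Lemma has_dbar_continuous rho f g : has_dbar rho f g ->
  continuous_on_square rho (fun a b => Re (f a b)).
Proof. by move=> [fx [fy [[]]]]. Qed.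

(** The divergence theorem: [Re g] is half of [d/dx (Re f) - d/dy (Im f)], and each term integrates
    to zero because [f] vanishes on the boundary. *)
Lemma plane_integral_dbar rho r f g : 0 < r -> r < rho -> has_dbar rho f g ->
  (forall a b, `|a| <= r -> `|b| <= r -> `|a| = r \/ `|b| = r -> f a b = 0) ->
  plane_integral r (fun a b => Re (g a b)) = 0.
Proof.
move=> r0 r_lt [fx [fy [rf imf gE]]] f0.
have rr : `|r| = r by rewrite gtr0_norm.
have rNr : `|- r| = r by rewrite normrN.
have I1 : plane_integral r (fun a b => Re (fx a b)) = 0.
  apply: (plane_integral_dx r0 r_lt rf) => b br.
  by rewrite !f0 ?rr ?rNr//; left.
have I2 : plane_integral r (fun a b => Im (fy a b)) = 0.
  apply: (plane_integral_dy r0 r_lt imf) => a ar.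
  by rewrite !f0 ?rr ?rNr//; right.
have [_ cfx _ _ _] := rf; have [_ _ cfy _ _] := imf.
have -> : plane_integral r (fun a b => Re (g a b)) =
    plane_integral r (fun a b => 2^-1 * (Re (fx a b) + -1 * Im (fy a b))).
  apply: eq_plane_integral => a b ar br.
  rewrite gE ?(le_lt_trans _ r_lt)//.
  have -> : (2^-1 : R[i]) = (2^-1 : R)%:C by rewrite fmorphV rmorph_nat.
  by rewrite complex_ReM complex_ReD complex_ReM/=; ring.
have cN : continuous_on_square rho (fun a b => -1 * Im (fy a b)).
  by apply: continuous_on_squareM => //; exact: continuous_on_square_cst.
rewrite (plane_integralZ _ r_lt); last exact: continuous_on_squareD.
rewrite (plane_integralD r_lt cfx cN) (plane_integralZ _ r_lt cfy) I1 I2.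
by rewrite mulr0 addr0 mulr0.
Qed.

End Dbar.

(** * An approximate identity *)

Section ApproximateIdentity.
Variable R : realType.
Local Open Scope classical_set_scope.
Local Notation mu := (@lebesgue_measure R).
Local Notation seg r := (`[(- r)%R, r%R]%classic : set R).

Lemma segment_integral_subset rho r s (u : R -> R) : s <= r -> r < rho ->
  (forall x : R, `|x| < rho -> {for x, continuous u}) -> (forall x, 0 <= u x) ->
  \int[mu]_(x in seg s) u x <= \int[mu]_(x in seg r) u x.
Proof.
move=> sr r_lt cu u0.
have ir := integrable_segment r_lt cu.
have is_ := integrable_segment (le_lt_trans sr r_lt) cu.
rewrite /Rintegral fine_le//.
- exact: integrable_fin_num is_.
- exact: integrable_fin_num ir.
apply: ge0_subset_integral => //.
- by case/integrableP: ir.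
- by move=> x _; rewrite lee_fin.
- by move=> x /=; rewrite !in_segmentN => /le_trans; apply.
Qed.

Lemma plane_integral_subset rho r s (f : R -> R -> R) : s <= r -> r < rho ->
  continuous_on_square rho f -> (forall a b, 0 <= f a b) ->
  plane_integral s f <= plane_integral r f.
Proof.
move=> sr r_lt cf f0; rewrite /plane_integral.
have s_lt := le_lt_trans sr r_lt.
apply: (@le_trans _ _ (\int[mu]_(a in seg s) (\int[mu]_(b in seg r) f a b))).
  apply: le_Rintegral => //.
  - exact: integrable_outer s_lt cf.
  - exact: (integrable_segment s_lt (continuous_inner r_lt cf)).
  move=> a; rewrite /= in_segmentN => /le_lt_trans/(_ s_lt) a_lt.
  apply: (segment_integral_subset sr r_lt) => // b b_lt.
  exact: continuous_on_square_r cf a_lt b_lt.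
apply: (segment_integral_subset sr r_lt); first exact: continuous_inner r_lt cf.
by move=> a; apply: Rintegral_ge0 => b _.
Qed.

Definition kernel_weight (eta a b : R) := (a ^+ 2 + b ^+ 2 + eta)^-1.

Lemma kernel_weight_gt0 eta a b : 0 < eta -> 0 < kernel_weight eta a b.
Proof. by move=> e0; rewrite invr_gt0; nra. Qed.

Lemma kernel_weight_C1 (rho eta : R) : 0 < eta ->
  C1_on_square rho (kernel_weight eta)
    (fun a b => - ((kernel_weight eta a b) ^+ 2 * (2 * a)))
    (fun a b => - ((kernel_weight eta a b) ^+ 2 * (2 * b))).
Proof.
move=> e0.
pose d a b : R := a * a + b * b + eta.
have d0 a b : d a b != 0 by apply: lt0r_neq0; rewrite /d; nra.
have := C1_on_squareV d0 (C1_on_squareD (C1_on_squareD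
  (C1_on_squareM (C1_on_square_fst rho) (C1_on_square_fst rho))
  (C1_on_squareM (C1_on_square_snd rho) (C1_on_square_snd rho)))
  (C1_on_square_cst rho eta)).
by congr C1_on_square; apply/funext => a; apply/funext => b;
  rewrite /d /kernel_weight -?expr2//; congr (- (_ * _)); ring.
Qed.

Lemma kernel_weight_continuous (rho eta : R) : 0 < eta ->
  continuous_on_square rho (kernel_weight eta).
Proof. by move=> e0; have [] := kernel_weight_C1 rho e0. Qed.

Lemma continuous_on_squareX rho (f : R -> R -> R) k : continuous_on_square rho f ->
  continuous_on_square rho (fun a b => f a b ^+ k).
Proof.
move=> cf; elim: k => [|k IH].
  by under eq_fun do under eq_fun do rewrite expr0; exact: continuous_on_square_cst.
by under eq_fun do under eq_fun do rewrite exprS; exact: (continuous_on_squareM cf IH).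
Qed.

(* The [j]-th d-bar derivative of [conj z ^ j / (|z|^2 + s^2)], divided by [j!]: positive, and of
   mass bounded below while it concentrates at the origin as [s] tends to [0]. *)
Definition poisson_like j (s a b : R) :=
  s ^+ (2 * j) * kernel_weight (s ^+ 2) a b ^+ j.+1.

Lemma poisson_like_continuous (rho : R) j s : 0 < s ->
  continuous_on_square rho (poisson_like j s).
Proof.
move=> s0; apply: continuous_on_squareM; first exact: continuous_on_square_cst.
by apply/continuous_on_squareX/kernel_weight_continuous; rewrite exprn_gt0.
Qed.

Lemma poisson_like_ge0 j s a b : 0 < s -> 0 <= poisson_like j s a b.
Proof.
by move=> s0; rewrite mulr_ge0 ?exprn_ge0 ?ltW// kernel_weight_gt0// exprn_gt0.
Qed.

(** On the square of half-side [s] one has [a^2 + b^2 + s^2 <= 3 s^2], so the integrand is at least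
    [1 / (3^(j+1) s^2)] there, on an area of [4 s^2]. *)
Lemma poisson_like_mass j (r s : R) : 0 < s -> s <= r ->
  4 / 3 ^+ j.+1 <= plane_integral r (poisson_like j s).
Proof.
move=> s0 sr.
have r_lt : r < r + 1 by lra.
have cP := @poisson_like_continuous (r + 1) j s s0.
apply: le_trans _ (plane_integral_subset sr r_lt cP (fun a b => poisson_like_ge0 j a b s0)).
have -> : 4 / 3 ^+ j.+1 = plane_integral s (fun _ _ => (3 ^+ j.+1 * s ^+ 2)^-1).
  rewrite plane_integral_cst ?(ltW s0)//; field.
  by rewrite !expf_neq0// ?pnatr_eq0// gt_eqF.
apply: (le_plane_integral (le_lt_trans sr r_lt)) => //.
  exact: continuous_on_square_cst.
move=> a b; rewrite !ler_norml => /andP[a1 a2] /andP[b1 b2].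
have s2 : 0 < s ^+ 2 by rewrite exprn_gt0.
have -> : (3 ^+ j.+1 * s ^+ 2)^-1 = s ^+ (2 * j) * ((3 * s ^+ 2)^-1) ^+ j.+1.
  rewrite exprVn exprMn exprM [(s ^+ 2) ^+ j.+1]exprS.
  by field; rewrite !expf_neq0// ?pnatr_eq0// gt_eqF.
rewrite /poisson_like ler_pM2l ?exprn_gt0//.
have W0 := kernel_weight_gt0 a b s2.
rewrite ler_pXn2r ?nnegrE ?(ltW W0)//; last by rewrite invr_ge0; nra.
rewrite lef_pV2 ?posrE//; nra.
Qed.

(** Near the origin [w] exceeds [w 0 0 / 2], and the mass there is bounded below; away from it
    [poisson_like] is [O(s)]. Hence [w 0 0 * 2 / 3^(j+1) <= B + O(s)], and [s] tends to [0]. *)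
Lemma poisson_like_eval j (r : R) (w : R -> R -> R) (B : R) : (0 < j)%N -> 0 < r -> 0 <= B ->
  continuous_on_square (2 * r) w ->
  (forall s : R, 0 < s -> s <= r -> s <= 1 ->
    plane_integral r (fun a b => poisson_like j s a b * w a b) <= B) ->
  w 0 0 <= 3 ^+ j.+1 * B.
Proof.
move=> j0 r0 B0 cw HB.
have T0 : 0 < 3 ^+ j.+1 :> R by rewrite exprn_gt0.
have [w0|w0] := leP (w 0 0) 0; first by apply: le_trans w0 _; rewrite mulr_ge0// ltW.
have r_lt : r < 2 * r by lra.
have [M M0 HM] := continuous_on_square_bounded cw r_lt.
have [d d0 Hd] : exists2 d : R, 0 < d & forall a b, `|a| < d -> `|b| < d -> w 0 0 / 2 <= w a b.
  have rr : `|0 : R| < 2 * r by rewrite normr0; lra.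
  have w2 : 0 < w 0 0 / 2 by lra.
  have := cw 0 0 rr rr; rewrite /continuous_at/= => /cvgrPdist_le/(_ _ w2)[[A1 A2] /= [[d1 /= d10 H1] [d2 /= d20 H2]] H].
  exists (Num.min d1 d2); first by rewrite lt_min d10 d20.
  move=> a b; rewrite !lt_min => /andP[ad _] /andP[_ bd].
  have : `|w 0 0 - w a b| <= w 0 0 / 2.
    by apply: (H (a, b)); split; [apply: H1|apply: H2]; rewrite /= sub0r normrN.
  move=> /ler_normlP[]; lra.
(* Outside the square of half-side [d], [poisson_like] is at most [s / d^(2(j+1))], using [0 < j]
   and [s <= 1], and [w 0 0 / 2 - w] is at most [M + w 0 0]; their product is at most [L * s]. *)
pose L := (M + w 0 0) / d ^+ (2 * j.+1).
have L0 : 0 <= L by rewrite divr_ge0 ?exprn_ge0 ?ltW// ltr_wpDl.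
have key s : 0 < s -> s <= r -> s <= 1 -> w 0 0 * (2 / 3 ^+ j.+1) <= B + 4 * r ^+ 2 * L * s.
  move=> s0 sr s1.
  have cP := @poisson_like_continuous (2 * r) j s s0.
  have cLP : continuous_on_square (2 * r) (fun a b => w 0 0 / 2 * poisson_like j s a b).
    by apply: continuous_on_squareM => //; exact: continuous_on_square_cst.
  have c1 : continuous_on_square (2 * r)
      (fun a b => w 0 0 / 2 * poisson_like j s a b + - (L * s)).
    by apply: continuous_on_squareD => //; exact: continuous_on_square_cst.
  have c2 := continuous_on_squareM cP cw.
  have := le_plane_integral r_lt c1 c2 _.
  rewrite (plane_integralD r_lt cLP (@continuous_on_square_cst _ _ _)).
  rewrite (plane_integralZ _ r_lt cP) plane_integral_cst ?(ltW r0)//.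
  have mass := poisson_like_mass j s0 sr.
  have wm : w 0 0 / 2 * (4 / 3 ^+ j.+1) <= w 0 0 / 2 * plane_integral r (poisson_like j s).
    by rewrite ler_pM2l//; lra.
  move=> H; have HBs := HB s s0 sr s1.
  (* It remains to prove the inequality pointwise: the error [L * s] is needed only outside the
     square of half-side [d]. *)
  suff /H{}H : forall a b, `|a| <= r -> `|b| <= r ->
      w 0 0 / 2 * poisson_like j s a b + - (L * s) <= poisson_like j s a b * w a b.
    have := le_trans (lerD wm (lexx _)) (le_trans H HBs); clear; lra.
  move=> a b ar br {H}.
  have P0 := poisson_like_ge0 j a b s0.
  have Ls : 0 <= L * s by rewrite mulr_ge0// ltW.
  have [adbd|] := boolP ((`|a| < d) && (`|b| < d)).
    by move: adbd => /andP[/Hd] /[apply]; nra.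
  rewrite negb_and -!leNgt => out.
  have PL : poisson_like j s a b * (M + w 0 0) <= L * s.
    have d2 : d ^+ 2 <= a ^+ 2 + b ^+ 2.
      case/orP: out => out.
        by rewrite -[a ^+ 2]real_normK ?num_real//; nra.
      by rewrite -[b ^+ 2]real_normK ?num_real//; nra.
    have W0 : 0 < kernel_weight (s ^+ 2) a b by apply: kernel_weight_gt0; rewrite exprn_gt0.
    have W : kernel_weight (s ^+ 2) a b <= (d ^+ 2)^-1.
      have s2 : 0 < s ^+ 2 by rewrite exprn_gt0.
      have dd : 0 < d ^+ 2 by rewrite exprn_gt0.
      by rewrite lef_pV2 ?posrE//; lra.
    have WX : kernel_weight (s ^+ 2) a b ^+ j.+1 <= (d ^+ (2 * j.+1))^-1.
      by rewrite exprM -exprVn ler_pXn2r ?nnegrE ?(ltW W0)// invr_ge0 exprn_ge0// ltW.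
    have sX : s ^+ (2 * j) <= s.
      rewrite -[leRHS]expr1; apply: ler_wiXn2l => //; first exact: ltW.
      by rewrite muln_gt0.
    have -> : L * s = s * (d ^+ (2 * j.+1))^-1 * (M + w 0 0) by rewrite /L; ring.
    rewrite ler_wpM2r ?addr_ge0 ?(ltW w0)// /poisson_like ler_pM ?exprn_ge0 ?(ltW s0) ?(ltW W0)//.
  have := HM a b ar br; rewrite ler_norml => /andP[wM _].
  have : poisson_like j s a b * (w 0 0 / 2 - w a b) <= poisson_like j s a b * (M + w 0 0).
    by rewrite ler_wpM2l//; lra.
  lra.
suff : w 0 0 * (2 / 3 ^+ j.+1) <= B.
  by rewrite mulrA ler_pdivrMr// => h; lra.
apply/ler_addgt0Pr => e e0.
(* The last entry makes the error [4 r^2 L s] at most [e]; the [+ 1] keeps the denominator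
   positive. *)
pose s := Num.min (Num.min r 1) (e / (4 * r ^+ 2 * L + 1)).
have D0 : 0 <= 4 * r ^+ 2 * L by have r2 := sqr_ge0 r; rewrite mulr_ge0 //; lra.
have D1 : 0 < 4 * r ^+ 2 * L + 1 by lra.
have s0 : 0 < s by rewrite !lt_min r0 ltr01 divr_gt0.
have := key s s0; rewrite /s !ge_min !lexx !orbT /= => /(_ isT isT).
rewrite -/s.
have : s <= e / (4 * r ^+ 2 * L + 1) by rewrite ge_min lexx orbT.
rewrite ler_pdivlMr//; nra.
Qed.

End ApproximateIdentity.

(** * Kernel, cutoff and the scalar estimate *)

Section CommutatorBound.
Variable R : realDomainType.

(* [X i k p l] stands for the integral of the [i]-th d-bar derivative of the kernel times the
   [k]-th one of the cutoff times [b p l]; the four-term relation is the divergence theorem. First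
   [p] is raised from [0] to [n] (at the cost of more derivatives on the kernel), then, as
   [b n.+1 = 0], [i] is raised to [n.+2] with [p = n] fixed. *)
Lemma four_index_bound (n M : nat) (B : R) (X : nat -> nat -> nat -> nat -> R) :
  0 <= B -> (2 * n + 2 < M)%N ->
  (forall i k p l, (i < n.+2)%N -> (k < M)%N ->
    X i.+1 k p l + X i k.+1 p l + X i k p.+1 l + X i k p l.+1 = 0) ->
  (forall i k l, (i <= n)%N -> (k <= 2 * n + 2)%N -> (l <= 2 * n + 2)%N -> `|X i k 0%N l| <= B) ->
  (forall i k l, X i k n.+1 l = 0) ->
  `|X n.+2 0%N n 0%N| <= 2 ^+ n.+2 * 3 ^+ n * B.
Proof.
move=> B0 nM rel base top.
(* Each lowering of [p] produces three terms, with one of [i], [k], [l] raised by one; the side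
   conditions keep the terms reached at [p = 0] in the range of [base]. *)
have step1 p i k l : (p <= n)%N -> (i + p <= n)%N -> (k + p <= 2 * n + 2)%N ->
    (l + p <= 2 * n + 2)%N -> `|X i k p l| <= 3 ^+ p * B.
  elim: p i k l => [|p IH] i k l pn ip kp lp.
    by rewrite expr0 mul1r; apply: base; lia.
  have r : X i k p.+1 l = - X i.+1 k p l - X i k.+1 p l - X i k p l.+1.
    have /(_ _ _)/(congr1 (fun x => x - X i.+1 k p l - X i k.+1 p l - X i k p l.+1)) := rel i k p l.
    rewrite sub0r => <-; [ring|lia|lia].
  have h1 : `|X i.+1 k p l| <= 3 ^+ p * B by apply: IH; lia.
  have h2 : `|X i k.+1 p l| <= 3 ^+ p * B by apply: IH; lia.
  have h3 : `|X i k p l.+1| <= 3 ^+ p * B by apply: IH; lia.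
  rewrite exprS; move: h1 h2 h3; rewrite r !ler_norml.
  by move=> /andP[? ?] /andP[? ?] /andP[? ?]; apply/andP; split; lra.
(* At [p = n] the term with [n.+1] vanishes and two terms remain. When [i] has come down to [0], [k]
   and [l] are at most [n + 2], which leaves room in [2 n + 2] for the [n] steps of [step1]. *)
have step2 i k l : (i + k <= n.+2)%N -> (i + l <= n.+2)%N ->
    `|X i k n l| <= 2 ^+ i * (3 ^+ n * B).
  elim: i k l => [|i IH] k l ik il.
    by rewrite expr0 mul1r; apply: step1; lia.
  have r : X i.+1 k n l = - X i k.+1 n l - X i k n l.+1.
    have /(_ _ _)/(congr1 (fun x => x - X i k.+1 n l - X i k n l.+1)) := rel i k n l.
    rewrite sub0r top => <-; [ring|lia|lia].
  have h1 : `|X i k.+1 n l| <= 2 ^+ i * (3 ^+ n * B) by apply: IH; lia.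
  have h2 : `|X i k n l.+1| <= 2 ^+ i * (3 ^+ n * B) by apply: IH; lia.
  rewrite exprS; move: h1 h2; rewrite r !ler_norml.
  by move=> /andP[? ?] /andP[? ?]; apply/andP; split; lra.
by rewrite -mulrA; apply: step2; lia.
Qed.

End CommutatorBound.

(** * The regularised kernel and its d-bar derivatives *)

Section Kernel.
Variable R : realType.
Local Open Scope complex_scope.
Local Notation Re := complex.Re.
Local Notation Im := complex.Im.
Local Notation normc := ComplexField.Normc.normc.

Lemma normc_Re (x : R[i]) : `|Re x| <= normc x.
Proof. by case: x => a b /=; rewrite -sqrtr_sqr ler_wsqrtr// lerDl sqr_ge0. Qed.

Lemma normc_ReIm (x : R[i]) : normc x <= `|Re x| + `|Im x|.
Proof.
case: x => a b /=; rewrite -[leRHS]ger0_norm ?addr_ge0// -sqrtr_sqr ler_wsqrtr//.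
by rewrite sqrrD !real_normK ?num_real// lerD2r lerDl mulrn_wge0// mulr_ge0.
Qed.

Lemma normc_ge0 (x : R[i]) : 0 <= normc x.
Proof. by case: x => a b /=; exact: sqrtr_ge0. Qed.

Lemma normcX (x : R[i]) k : normc (x ^+ k) = normc x ^+ k.
Proof.
by elim: k => [|k IH]; rewrite ?expr0 ?ComplexField.Normc.normc1// !exprS
  ComplexField.Normc.normcM IH.
Qed.

Lemma normc_real (a : R) : normc a%:C = `|a|.
Proof. by rewrite /= expr0n /= addr0 sqrtr_sqr. Qed.

Lemma normc_nat k : normc (k%:R : R[i]) = k%:R.
Proof. by rewrite -(rmorph_nat (real_complex R)) normc_real ger0_norm ?ler0n. Qed.

Lemma normcD (x y : R[i]) : normc (x + y) <= normc x + normc y.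
Proof. exact: (@le_normcD R x y). Qed.

Lemma sqr_normc_conj (a b : R) : normc (a -i* b) ^+ 2 = a ^+ 2 + b ^+ 2.
Proof. by rewrite /= sqrrN sqr_sqrtr ?addr_ge0 ?sqr_ge0. Qed.

(** The parameter type [T] is arbitrary so that it can contain [eta] next to the point: the bounds
    obtained are uniform in [eta]. *)
Lemma normc_sum_bound (T I : Type) (D : T -> Prop) (s : seq I) (F : I -> T -> R[i]) :
  (forall i, exists2 M, 0 <= M & forall x, D x -> normc (F i x) <= M) ->
  exists2 M, 0 <= M & forall x, D x -> normc (\sum_(i <- s) F i x) <= M.
Proof.
move=> FM; elim: s => [|i s [M M0 HM]].
  by exists 0 => // x _; rewrite big_nil ComplexField.Normc.normc0.
have [N N0 HN] := FM i; exists (N + M); first exact: addr_ge0.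
move=> x Dx; rewrite big_cons; apply: le_trans (normcD _ _) _.
by apply: lerD; [exact: HN|exact: HM].
Qed.

Variable j : nat.

(** The solution of the recursion [kernel_coef_rec] with value [1] at [i = m = 0]. At [i = j] the
    binomial vanishes for all [m < j]. *)
Definition kernel_coef i m : nat := (i`! * 'C(j.-1 - m, i - m))%N.

Definition kernel_term (eta : R) q m (a b : R) : R[i] :=
  (eta ^+ m)%:C * (a -i* b) ^+ q * (kernel_weight eta a b)%:C ^+ m.+1.

(* The closed form, for [i <= j], of the [i]-th d-bar derivative of [conj z ^ j / (|z|^2 + eta)]. *)
Definition kernel (eta : R) i (a b : R) : R[i] :=
  \sum_(m < i.+1) (kernel_coef i m)%:R * kernel_term eta (j - i) m a b.

Lemma has_dbar_weight (rho eta : R) : 0 < eta ->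
  has_dbar rho (fun a b : R => (kernel_weight eta a b)%:C)
    (fun a b => - ((a +i* b) * (kernel_weight eta a b)%:C ^+ 2)).
Proof.
move=> e0; apply: (has_dbar_eq (has_dbar_real (kernel_weight_C1 rho e0))) => a b _ _.
rewrite [a +i* b]complexE /= !rmorphN !rmorphM/= rmorph_nat.
by field.
Qed.

Lemma kernel_weight_mul (eta a b : R) : 0 < eta ->
  (a -i* b) * ((a +i* b) * (kernel_weight eta a b)%:C) = 1 - (eta * kernel_weight eta a b)%:C.
Proof.
move=> e0; have d0 : a ^+ 2 + b ^+ 2 + eta != 0 by apply: lt0r_neq0; nra.
rewrite mulrA (_ : (a -i* b) * (a +i* b) = (a ^+ 2 + b ^+ 2)%:C); last first.
  by apply/eqP; rewrite eq_complex/=; apply/andP; split; apply/eqP; ring.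
rewrite -rmorphM -(rmorph1 (real_complex R)) -rmorphB /kernel_weight; congr (_%:C).
by field.
Qed.

(** With [W] the weight, the d-bar derivative of [W] is [- z W^2], and [conj z * z * W = 1 - eta W]:
    differentiating the power of [W] gives back a term of the same shape and one with [m] raised. *)
Lemma has_dbar_kernel_term (rho eta : R) q m : 0 < eta ->
  has_dbar rho (kernel_term eta q.+1 m) (fun a b =>
    (q%:R - m%:R) * kernel_term eta q m a b + m.+1%:R * kernel_term eta q m.+1 a b).
Proof.
move=> e0.
have := has_dbarM (has_dbarM (has_dbar_cst rho (eta ^+ m)%:C)
  (has_dbarX q.+1 (has_dbar_conj rho))) (has_dbarX m.+1 (has_dbar_weight rho e0)).
move/has_dbar_eq; apply => a b _ _ /=.
have := kernel_weight_mul a b e0; rewrite /kernel_term.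
set z := (a -i* b); set w := (a +i* b); set W := (kernel_weight eta a b)%:C => zwW.
have E : z ^+ q.+1 * (w * W) = z ^+ q * (1 - eta%:C * W).
  by rewrite exprSr -mulrA zwW rmorphM.
have -> : (eta ^+ m.+1)%:C = eta%:C * (eta ^+ m)%:C by rewrite exprS rmorphM.
have -> : (eta ^+ m)%:C * z ^+ q.+1 * (m.+1%:R * W ^+ m * - (w * W ^+ 2)) =
    - (eta ^+ m)%:C * m.+1%:R * W ^+ m.+1 * (z ^+ q.+1 * (w * W)).
  by rewrite [W ^+ m.+1]exprS; ring.
rewrite E !exprS; rewrite -[q.+1]addn1 -[m.+1]addn1 !natrD; ring.
Qed.

(** Comparison of the coefficients produced by [has_dbar_kernel_term]; it comes down to Pascal's
    rule and the absorption identity for binomials. At [m = 0] the junk value [m.-1] is cancelled by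
    the factor [m]. *)
Lemma kernel_coef_rec i m : (i < j)%N -> (m <= i)%N ->
  ((kernel_coef i.+1 m)%:R : R[i]) =
  (kernel_coef i m)%:R * ((j - i.+1)%:R - m%:R) + (kernel_coef i m.-1)%:R * m%:R.
Proof.
move=> ij mi.
(* Stated additively in [nat], because [(j - i.+1)%:R - m%:R] may be negative. *)
have E : (kernel_coef i.+1 m + kernel_coef i m * m =
    kernel_coef i m * (j - i.+1) + kernel_coef i m.-1 * m)%N.
  rewrite /kernel_coef factS subSn//.
  have := mul_bin_left (j.-1 - m) (i - m).
  rewrite (_ : (j.-1 - m - (i - m) = j - i.+1)%N); last by lia.
  case: m mi => [|m] mi /= B.
    by move: B; rewrite !muln0 !addn0 !subn0 mulnAC => ->; ring.
  rewrite (_ : (j.-1 - m = (j.-1 - m.+1).+1)%N); last by lia.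
  rewrite (_ : (i - m = (i - m.+1).+1)%N) ?binS; last by lia.
  set u := 'C(_, i - m.+1) in B *; set v := 'C(_, _) in B *.
  transitivity (i`! * ((i - m.+1).+1 * v) + m.+1 * i`! * v + i`! * u * m.+1)%N.
    by rewrite {1}(_ : i.+1 = ((i - m.+1).+1 + m.+1)%N); [ring|lia].
  by rewrite B; ring.
apply: (@addIr _ ((kernel_coef i m)%:R * m%:R)).
by rewrite -natrM -natrD E natrD !natrM; ring.
Qed.

Lemma has_dbar_kernel (rho eta : R) i : 0 < eta -> (i < j)%N ->
  has_dbar rho (kernel eta i) (kernel eta i.+1).
Proof.
move=> e0 ij.
have jiE : (j - i = (j - i.+1).+1)%N by lia.
have dterm (m : 'I_i.+1) : true -> has_dbar rho
    (fun a b => (kernel_coef i m)%:R * kernel_term eta (j - i) m a b) (fun a b =>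
    (kernel_coef i m)%:R * (((j - i.+1)%:R - m%:R) * kernel_term eta (j - i.+1) m a b +
       m.+1%:R * kernel_term eta (j - i.+1) m.+1 a b)).
  move=> _; rewrite jiE.
  have := has_dbarM (has_dbar_cst rho (kernel_coef i m)%:R)
    (has_dbar_kernel_term rho (j - i.+1) m e0).
  by move/has_dbar_eq; apply => a b _ _; rewrite mul0r add0r.
apply: (has_dbar_eq (has_dbar_sum _ dterm)) => a b _ _.
rewrite /kernel; set T := fun m => kernel_term eta (j - i.+1) m a b.
rewrite (eq_bigr (fun m : 'I_i.+1 =>
    (kernel_coef i m)%:R * ((j - i.+1)%:R - m%:R) * T m +
    (kernel_coef i m)%:R * m.+1%:R * T m.+1)); last by move=> m _; rewrite mulrDr !mulrA.
rewrite big_split /=.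
(* The raised terms are reindexed by [m + 1]; the added summand at [0] carries the factor [0]. *)
have -> : \sum_(m < i.+1) (kernel_coef i m)%:R * m.+1%:R * T m.+1 =
   \sum_(m < i.+2) (kernel_coef i m.-1)%:R * m%:R * T m.
  by rewrite [RHS]big_ord_recl /= mulr0 mul0r add0r; apply: eq_bigr.
(* The recursion covers [m <= i]; the top summand [m = i + 1] only says that
   [i! (i + 1) = (i + 1)!]. *)
rewrite [X in _ + X]big_ord_recr [RHS]big_ord_recr /= addrA -big_split /=.
congr (_ + _).
  apply: eq_bigr => m _; rewrite -mulrDl -kernel_coef_rec//.
  by rewrite -ltnS ltn_ord.
rewrite -/(T _) /kernel_coef !subnn !bin0 !muln1 factS natrM.
by rewrite [(i.+1)%:R * _]mulrC.
Qed.

(** Only [m = j] survives, and no power of [conj z] is left: the top derivative is a positive real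
    function. *)
Lemma kernel_top (eta a b : R) : (0 < j)%N ->
  kernel eta j a b = (j`!%:R * eta ^+ j * kernel_weight eta a b ^+ j.+1)%:C.
Proof.
move=> j0; rewrite /kernel big_ord_recr /= big1 ?add0r; last first.
  by move=> [m mj] _ /=; rewrite /kernel_coef bin_small ?muln0 ?mul0r//; lia.
(* The truncated difference [j.-1 - j] is [0], so the last binomial is [1]. *)
rewrite /kernel_coef /kernel_term subnn (_ : (j.-1 - j = 0)%N) ?bin0 ?muln1; last by lia.
by rewrite expr0 mulr1 !rmorphM /= !rmorphXn /= rmorph_nat mulrA.
Qed.

(** As [i + 2 <= j], two factors [conj z] can be set against one weight [W]: [|z|^2 W <= 1], while
    [eta^m W^m <= 1]. What remains is a power of [|z|], so the bound does not depend on [eta]. *)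
Lemma kernel_bound i (r : R) : (i.+2 <= j)%N -> 0 <= r ->
  exists2 M, 0 <= M & forall eta a b : R, 0 < eta -> `|a| <= r -> `|b| <= r ->
    normc (kernel eta i a b) <= M.
Proof.
move=> ij r0.
have [|M M0 HM] := @normc_sum_bound (R * R * R)%type 'I_i.+1
  (fun x => [/\ 0 < x.1.1, `|x.1.2| <= r & `|x.2| <= r]) (index_enum _)
  (fun m x => (kernel_coef i m)%:R * kernel_term x.1.1 (j - i) m x.1.2 x.2); last first.
  by exists M => // eta a b e0 ar br; exact: (HM (eta, a, b)).
move=> m; exists ((kernel_coef i m)%:R * (2 * r) ^+ (j - i.+2)).
  by rewrite mulr_ge0// exprn_ge0//; lra.
move=> [[eta a] b] /= [e0 ar br].
have ji : (j - i = (j - i.+2) + 2)%N by lia.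
rewrite ComplexField.Normc.normcM normc_nat ler_wpM2l ?ler0n//.
rewrite /kernel_term !ComplexField.Normc.normcM ji exprD !normcX normc_real.
rewrite ComplexField.Normc.normcM !normcX sqr_normc_conj normc_real.
have W0 := kernel_weight_gt0 a b e0.
set W := kernel_weight eta a b in W0 *.
rewrite !ger0_norm ?exprn_ge0 ?(ltW e0) ?(ltW W0)//.
have zr : normc (a -i* b) ^+ (j - i.+2) <= (2 * r) ^+ (j - i.+2).
  apply: lerXn2r; rewrite ?nnegrE ?normc_ge0//; first by lra.
  by apply: le_trans (normc_ReIm _) _; rewrite /= normrN; lra.
have WE : W * (a ^+ 2 + b ^+ 2 + eta) = 1.
  by rewrite mulVf// lt0r_neq0//; nra.
have a2 := sqr_ge0 a; have b2 := sqr_ge0 b.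
have le1 : eta ^+ m * W ^+ m <= 1.
  rewrite -exprMn; apply: exprn_ile1; nra.
have le2 : (a ^+ 2 + b ^+ 2) * W <= 1 by nra.
have -> : eta ^+ m * (normc (a -i* b) ^+ (j - i.+2) * (a ^+ 2 + b ^+ 2)) * W ^+ m.+1 =
  normc (a -i* b) ^+ (j - i.+2) * ((eta ^+ m * W ^+ m) * ((a ^+ 2 + b ^+ 2) * W)).
  by rewrite [W ^+ m.+1]exprS; ring.
rewrite -[leRHS]mulr1; apply: ler_pM => //.
- by rewrite exprn_ge0// normc_ge0.
- by rewrite !mulr_ge0 ?exprn_ge0 ?addr_ge0 ?(ltW e0) ?(ltW W0).
- by rewrite mulr_ile1// ?mulr_ge0 ?exprn_ge0 ?addr_ge0 ?(ltW e0) ?(ltW W0).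
Qed.

End Kernel.

(** * A polynomial cutoff vanishing to order [M] on the sides of the square *)

Section Cutoff.
Variable R : realType.
Variables (M : nat) (r : R).
Local Open Scope complex_scope.

Definition cutoff_poly : {poly R} := ((r ^+ 2)%:P - 'X ^+ 2) ^+ M.

Lemma derivn_expr_factor (q : {poly R}) m i : (i <= m)%N ->
  exists s, (q ^+ m)^`(i) = q ^+ (m - i) * s.
Proof.
elim: i => [|i IH] im; first by exists 1; rewrite derivn0 subn0 mulr1.
have [s sE] := IH (ltnW im).
rewrite derivnS sE derivM deriv_exp.
exists ((q^`() *+ (m - i)) * s + q * s^`()).
have -> : (m - i = (m - i.+1).+1)%N by lia.
by rewrite [q ^+ _.+1]exprSr /= mulrDr mulrA -!mulrnAl; ring.
Qed.

Lemma cutoff_poly_root i x : (i < M)%N -> `|x| = r -> cutoff_poly^`(i).[x] = 0.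
Proof.
move=> iM xr; have [s ->] := derivn_expr_factor ((r ^+ 2)%:P - 'X ^+ 2) (ltnW iM).
rewrite hornerM horner_exp !hornerE -xr real_normK ?num_real// subrr.
by rewrite expr0n; case: (M - i)%N (subn_gt0 i M) => [|k]; rewrite ?iM ?mul0r.
Qed.

(** The [k]-th d-bar derivative of the partial derivative of order [(i, m)] of the product cutoff.
    Carrying [i] and [m] makes the d-bar rule hold by unfolding. *)
Fixpoint cutoff k i m (a b : R) : R[i] :=
  if k is k'.+1 then 2^-1 * (cutoff k' i.+1 m a b + 'i%C * cutoff k' i m.+1 a b)
  else (cutoff_poly^`(i).[a] * cutoff_poly^`(m).[b])%:C.

Lemma has_dbar_cutoff rho k i m : has_dbar rho (cutoff k i m) (cutoff k.+1 i m).
Proof.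
elim: k i m => [|k IH] i m.
  exact: has_dbar_real (C1_on_square_poly rho cutoff_poly^`(i) cutoff_poly^`(m)).
have := has_dbarM (has_dbar_cst rho 2^-1) (has_dbarD (IH i.+1 m)
  (has_dbarM (has_dbar_cst rho 'i%C) (IH i m.+1))).
by move/has_dbar_eq; apply => a b _ _ /=; rewrite !mul0r !add0r.
Qed.

Lemma cutoff_boundary k i m a b : (k + i < M)%N -> (k + m < M)%N ->
  `|a| = r \/ `|b| = r -> cutoff k i m a b = 0.
Proof.
move=> + + ab; elim: k i m => [|k IH] i m ki km.
  by case: ab => /cutoff_poly_root h /=; rewrite h ?mul0r ?mulr0.
by rewrite /= !IH ?mulr0 ?addr0 ?mulr0//; lia.
Qed.

Lemma cutoff_center : cutoff 0 0 0 0 0 = (r ^+ (4 * M))%:C.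
Proof.
rewrite /= /cutoff_poly horner_exp !hornerE expr0n /= subr0 -expr2 -!exprM.
by congr (r ^+ _)%:C; lia.
Qed.

End Cutoff.

(** * The bound at the centre of a square, for scalar functions *)

Section PointwiseBound.
Variable R : realType.
Local Open Scope complex_scope.
Local Notation Re := complex.Re.
Local Notation Im := complex.Im.
Local Notation normc := ComplexField.Normc.normc.

Lemma has_dbar_bounded (rho r : R) f g : has_dbar rho f g -> r < rho ->
  exists2 M, 0 <= M & forall a b, `|a| <= r -> `|b| <= r -> normc (f a b) <= M.
Proof.
move=> [fx [fy [[cre _ _ _ _] [cim _ _ _ _] _]]] r_lt.
have [M1 M10 H1] := continuous_on_square_bounded cre r_lt.
have [M2 M20 H2] := continuous_on_square_bounded cim r_lt.
exists (M1 + M2); first exact: addr_ge0.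
move=> a b ar br; apply: le_trans (normc_ReIm _) _.
by apply: lerD; [exact: H1|exact: H2].
Qed.

(** Supplies the regularity of the integrands for every [i], including [i = j], where
    [has_dbar_kernel] stops. *)
Lemma has_dbar_kernel_ex (rho eta : R) j i : 0 < eta ->
  exists g, has_dbar rho (kernel j eta i) g.
Proof.
move=> e0.
have dW := has_dbar_weight rho e0.
have dterm (m : 'I_i.+1) : exists g, has_dbar rho
    (fun a b => (kernel_coef j i m)%:R * kernel_term eta (j - i) m a b) g.
  eexists; apply: has_dbarM; first exact: has_dbar_cst.
  apply: has_dbarM; last exact: has_dbarX dW.
  apply: has_dbarM; first exact: has_dbar_cst.
  exact: has_dbarX (has_dbar_conj rho).
have [G HG] := choice dterm.
by eexists; apply: (@has_dbar_sum _ _ _ _ _ _ G) => m _; exact: HG.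
Qed.

Lemma uniform_bound (P : nat -> R -> Prop) n :
  (forall i M M', M <= M' -> P i M -> P i M') ->
  (forall i, (i <= n)%N -> exists2 M, 0 <= M & P i M) ->
  exists2 M, 0 <= M & forall i, (i <= n)%N -> P i M.
Proof.
move=> mono; elim: n => [|n IH] H.
  have [M M0 PM] := H 0%N isT; exists M => // i.
  by rewrite leqn0 => /eqP ->.
have [|M M0 PM] := IH; first by move=> i /leqW; exact: H.
have [N N0 PN] := H n.+1 (leqnn _).
exists (M + N); first exact: addr_ge0.
move=> i; rewrite leq_eqVlt => /predU1P[->|].
  by apply: mono PN; rewrite lerDr.
by rewrite ltnS => /PM; apply: mono; rewrite lerDl.
Qed.

(** The hypothesis on [b] is the Leibniz rule for a commutator: d-bar hits either the operator ([p])
    or the function ([l]). [four_index_bound] estimates the integral against the top derivative of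
    the kernel uniformly in [eta], and [poisson_like_eval] extracts the value at the centre. *)
Lemma commutator_chain_bound n (r : R) : 0 < r -> exists2 C, 0 <= C &
  forall (b : nat -> nat -> R -> R -> R[i]) (eps : R),
    (forall p l, has_dbar (2 * r) (b p l) (fun x y => b p.+1 l x y + b p l.+1 x y)) ->
    (forall l x y, b n.+1 l x y = 0) ->
    (forall l x y, (l <= 2 * n + 2)%N -> `|x| <= r -> `|y| <= r -> normc (b 0%N l x y) <= eps) ->
    Re (b n 0%N 0 0) <= C * eps.
Proof.
move=> r0; have r_lt : r < 2 * r by lra.
(* One more than the largest number of derivatives that fall on the cutoff in the scheme. *)
pose M := (2 * n + 3)%N.
pose chi k := cutoff M r k 0 0.
have [MK MK0 HMK] : exists2 MK, 0 <= MK & forall i, (i <= n)%N ->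
    forall eta a b, 0 < eta -> `|a| <= r -> `|b| <= r -> normc (kernel n.+2 eta i a b) <= MK.
  apply: uniform_bound.
    by move=> i m m' mm' H eta a b e0 ar br; apply: le_trans mm'; exact: H.
  by move=> i ni; apply: kernel_bound => //; exact: ltW.
have [MC MC0 HMC] : exists2 MC, 0 <= MC & forall k, (k <= 2 * n + 2)%N ->
    forall a b, `|a| <= r -> `|b| <= r -> normc (chi k a b) <= MC.
  apply: uniform_bound.
    by move=> i m m' mm' H a b ar br; apply: le_trans mm'; exact: H.
  by move=> k _; apply: has_dbar_bounded r_lt; exact: has_dbar_cutoff.
(* The factorial comes from [kernel_top], the power of [r] is the value of the cutoff at the
   centre. *)
pose D := (n.+2)`!%:R * r ^+ (4 * M).
have D0 : 0 < D by rewrite mulr_gt0 ?exprn_gt0// ltr0n fact_gt0.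
(* In order: the loss in [poisson_like_eval] for [j = n + 2], the number of terms in
   [four_index_bound], the area of the square, the bounds of kernel and cutoff. *)
pose C1 := 3 ^+ n.+3 * (2 ^+ n.+2 * 3 ^+ n * (4 * r ^+ 2 * (MK * MC))).
have r0' := ltW r0.
have C10 : 0 <= C1 by do ?[apply: mulr_ge0 => //]; apply: exprn_ge0.
exists (C1 / D); first by rewrite divr_ge0// ltW.
move=> b eps db btop bsmall.
have eps0 : 0 <= eps.
  by apply: le_trans (normc_ge0 _) (bsmall 0%N 0 0 _ _ _) => //; rewrite normr0 ltW.
pose B := 4 * r ^+ 2 * (MK * MC * eps).
have B0 : 0 <= B by do ?[apply: mulr_ge0 => //]; apply: exprn_ge0.
rewrite mulrAC ler_pdivlMr// mulrC.
pose w a c := (n.+2)`!%:R * Re (chi 0%N a c * b n 0%N a c).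
have dchi k : has_dbar (2 * r) (chi k) (chi k.+1) by exact: has_dbar_cutoff.
have -> : D * Re (b n 0%N 0 0) = w 0 0.
  by rewrite /w /chi cutoff_center complex_ReM /= /D; ring.
have -> : C1 * eps = 3 ^+ n.+3 * (2 ^+ n.+2 * 3 ^+ n * B) by rewrite /C1 /B; ring.
have cw : continuous_on_square (2 * r) w.
  apply: continuous_on_squareM; first exact: continuous_on_square_cst.
  exact: has_dbar_continuous (has_dbarM (dchi 0%N) (db n 0%N)).
apply: (poisson_like_eval (j := n.+2) _ r0 _ cw) => //; first by do ?[apply: mulr_ge0 => //]; apply: exprn_ge0.
move=> s s0 _ _.
have e0 : 0 < s ^+ 2 by rewrite exprn_gt0.
(* With this [eta] the kernel of order [n + 2] is [(n + 2)!] times [poisson_like]. *)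
set eta := s ^+ 2 in e0.
pose F i k p l a c := kernel n.+2 eta i a c * chi k a c * b p l a c.
pose X i k p l := plane_integral r (fun a c => Re (F i k p l a c)).
have dF i k p l : exists g, has_dbar (2 * r) (F i k p l) g.
  have [g dg] := has_dbar_kernel_ex (2 * r) n.+2 i e0.
  by eexists; apply: has_dbarM (db p l); apply: has_dbarM dg (dchi k).
have cF i k p l : continuous_on_square (2 * r) (fun a c => Re (F i k p l a c)).
  by have [g dg] := dF i k p l; exact: has_dbar_continuous dg.
have -> : plane_integral r (fun a c => poisson_like n.+2 s a c * w a c) = X n.+2 0%N n 0%N.
  apply: eq_plane_integral => a c _ _.
  rewrite /F kernel_top// -mulrA complex_ReM /= mul0r oppr0 addr0 /poisson_like /w exprM -/eta.
  by ring.
apply: le_trans (ler_norm _) _; apply: (@four_index_bound R n M) => //.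
- by rewrite /M ltn_add2l.
- move=> i k p l i_lt k_lt.
  have dK := has_dbar_kernel (2 * r) e0 i_lt.
  have F0 a c : `|a| <= r -> `|c| <= r -> `|a| = r \/ `|c| = r -> F i k p l a c = 0.
    by move=> _ _ ac; rewrite /F [chi k a c]cutoff_boundary ?addn0// mulr0 mul0r.
  have h := plane_integral_dbar r0 r_lt (has_dbarM (has_dbarM dK (dchi k)) (db p l)) F0.
  have c1 := continuous_on_squareD (cF i.+1 k p l) (cF i k.+1 p l).
  have c2 := continuous_on_squareD c1 (cF i k p.+1 l).
  have e1 := plane_integralD r_lt (cF i.+1 k p l) (cF i k.+1 p l).
  have e2 := plane_integralD r_lt c1 (cF i k p.+1 l).
  have e3 := plane_integralD r_lt c2 (cF i k p l.+1).
  rewrite e2 e1 in e3; rewrite -[LHS]e3 -[RHS]h.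
  apply: eq_plane_integral => a c _ _; rewrite /F -!complex_ReD; congr Re.
  by ring.
- move=> i k l ni nk nl; rewrite /X.
  apply: (plane_integral_bound (ltW r0) r_lt) => // a c ar cr.
  apply: le_trans (normc_Re _) _; rewrite !ComplexField.Normc.normcM.
  by do ?[apply: ler_pM]; rewrite ?mulr_ge0 ?normc_ge0//; [exact: HMK|exact: HMC|exact: bsmall].
- move=> i k l; rewrite /X /F.
  under eq_fun do under eq_fun do rewrite btop mulr0 /=.
  by rewrite plane_integral_cst ?mulr0// ltW.
Qed.

End PointwiseBound.

(** * Inner products and adjoints *)

Section InnerProduct.
Variables (R : realType) (H : lmodType (C R)) (ip : {dot H for Num.conj}).
Local Notation hn := (hnorm ip).
Local Notation normc := ComplexField.Normc.normc.

Lemma ipDl x y z : ip (x + y) z = ip x z + ip y z.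
Proof. exact: linearDl. Qed.

Lemma ipDr x y z : ip x (y + z) = ip x y + ip x z.
Proof. exact: linearDr. Qed.

Lemma ipZl a x y : ip (a *: x) y = a * ip x y.
Proof. exact: linearZl_LR. Qed.

Lemma ipZr a x y : ip x (a *: y) = a^* * ip x y.
Proof. exact: linearZr_LR. Qed.

Lemma ipC x y : ip x y = (ip y x)^*.
Proof. by rewrite hermC expr0 mul1r. Qed.

Lemma ipBl x y z : ip (x - y) z = ip x z - ip y z.
Proof. exact: linearBl. Qed.

Lemma ipBr x y z : ip x (y - z) = ip x y - ip x z.
Proof. exact: linearBr. Qed.

Lemma ip_eq (x y : H) : (forall z, ip x z = ip y z) -> x = y.
Proof.
move=> xy; apply/eqP; rewrite -subr_eq0 -[_ == 0]negbK -(dnorm_gt0 ip) ipBl xy subrr.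
by rewrite ltxx.
Qed.

Lemma ip_ge0 x : 0 <= ip x x.
Proof. exact: dnorm_ge0. Qed.

Lemma ip_self x : ip x x = (hn x ^+ 2)%:C%C.
Proof.
have := ip_ge0 x; rewrite /hnorm.
case: (ip x x) => a b; rewrite lecE /= => /andP[/eqP -> a0].
by rewrite sqr_sqrtr.
Qed.

Lemma hnorm_ge0 x : 0 <= hn x.
Proof. exact: sqrtr_ge0. Qed.

Lemma sqr_hnorm x : hn x ^+ 2 = complex.Re (ip x x).
Proof. by rewrite ip_self. Qed.

Lemma mul_conj_normc (c : C R) : c * c^* = (normc c ^+ 2)%:C%C.
Proof. by rewrite -normCK rmorphXn. Qed.

Lemma ip_conj_re x y : complex.Re (ip x y) = complex.Re (ip y x).
Proof. by rewrite ipC; case: (ip y x). Qed.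

Lemma cauchy_schwarz x y : normc (ip x y) <= hn x * hn y.
Proof.
have [-> | y0] := eqVneq y 0.
  by rewrite linear0r ComplexField.Normc.normc0 mulr_ge0 ?hnorm_ge0.
have d0 : 0 < hn y ^+ 2.
  by have := dnorm_gt0 ip y; rewrite y0 ip_self (ltcR 0).
have [hx hy] := (hnorm_ge0 x, hnorm_ge0 y).
have nc0 := normc_ge0 (ip x y).
(* [|y|^2] times the component of [x] orthogonal to [y], which avoids division. *)
have E : ip ((hn y ^+ 2)%:C%C *: x - ip x y *: y) ((hn y ^+ 2)%:C%C *: x - ip x y *: y) =
    (hn y ^+ 2 * (hn y ^+ 2 * hn x ^+ 2 - normc (ip x y) ^+ 2))%:C%C.
  rewrite !(ipBl, ipBr, ipZl, ipZr) [ip y x]ipC !ip_self.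
  rewrite [RHS](_ : _ = (hn y ^+ 2)%:C%C * ((hn y ^+ 2)%:C%C * (hn x ^+ 2)%:C%C -
    ip x y * (ip x y)^*) :> C R); last by rewrite mul_conj_normc -rmorphM -rmorphB -rmorphM.
  rewrite (_ : ((hn y ^+ 2)%:C%C)^* = (hn y ^+ 2)%:C%C :> C R); last first.
    by rewrite /Num.conj /= oppr0.
  by ring.
have := ip_ge0 ((hn y ^+ 2)%:C%C *: x - ip x y *: y).
rewrite E (lecR 0) pmulr_rge0// subr_ge0 -exprMn => /(@ler_wsqrtr R).
by rewrite !sqrtr_sqr !ger0_norm ?mulr_ge0// mulrC.
Qed.

Lemma hnormD x y : hn (x + y) <= hn x + hn y.
Proof.
have [hx hy] := (hnorm_ge0 x, hnorm_ge0 y).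
rewrite -(@ler_pXn2r _ 2) ?nnegrE ?addr_ge0 ?hnorm_ge0//.
rewrite [leLHS]sqr_hnorm ipDl !ipDr !complex_ReD [X in _ + (X + _)]ip_conj_re -!sqr_hnorm.
have := le_trans (ler_norm _) (le_trans (normc_Re (ip x y)) (cauchy_schwarz x y)).
by rewrite sqrrD; lra.
Qed.

Lemma hnormZ (a : C R) x : hn (a *: x) = normc a * hn x.
Proof.
rewrite -[LHS]ger0_norm ?hnorm_ge0// -[RHS]ger0_norm ?mulr_ge0 ?normc_ge0 ?hnorm_ge0//.
rewrite -!sqrtr_sqr; congr Num.sqrt.
by rewrite sqr_hnorm ipZl ipZr mulrA mul_conj_normc ip_self -rmorphM /= -exprMn.
Qed.

Lemma hnorm0 : hn 0 = 0.
Proof. by rewrite -(scale0r (0 : H)) hnormZ ComplexField.Normc.normc0 mul0r. Qed.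

Lemma hnormN x : hn (- x) = hn x.
Proof. by rewrite -scaleN1r hnormZ normcN ComplexField.Normc.normc1 mul1r. Qed.

End InnerProduct.

(** * Adjoint pairs and normality of a power *)

Section Adjoint.
Variables (R : realType) (H : lmodType (C R)) (ip : {dot H for Num.conj}).
Local Notation hn := (hnorm ip).
Variables (S S' : H -> H).
Hypothesis SS' : is_adjoint ip S S'.

Lemma adjoint_sym : is_adjoint ip S' S.
Proof. by move=> x y; rewrite ipC -SS' -ipC. Qed.

(** Linearity is drawn from adjointness, so that the results apply equally to an operator and to its
    adjoint, which is given as a bare function. *)
Lemma adjoint_additive x y : S (x + y) = S x + S y.
Proof. by apply: (@ip_eq _ _ ip) => z; rewrite ipDl !SS' ipDl. Qed.

Lemma adjoint_scale a x : S (a *: x) = a *: S x.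
Proof. by apply: (@ip_eq _ _ ip) => z; rewrite ipZl !SS' ipZl. Qed.

Lemma adjoint_iter k : is_adjoint ip (iter k S) (iter k S').
Proof. by elim: k => [|k IH] x y //; rewrite iterS SS' IH -iterSr. Qed.

(** [|S' y|^2 = <S (S' y), y> <= M |S' y| |y|], divided by [|S' y|] when it is nonzero. *)
Lemma adjoint_bounded : bounded_op ip S -> bounded_op ip S'.
Proof.
move=> [M HM]; exists M => y.
have [z|pos] := eqVneq (hn (S' y)) 0.
  have M0 : 0 <= M * hn y by apply: le_trans (HM y); exact: hnorm_ge0.
  by rewrite z.
have gt0 : 0 < hn (S' y) by rewrite lt_def pos hnorm_ge0.
rewrite -(ler_pM2r gt0) -expr2 sqr_hnorm -SS'.
apply: le_trans (ler_norm _) _; apply: le_trans (normc_Re _) _.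
apply: le_trans (cauchy_schwarz _ _ _) _.
by rewrite mulrAC ler_wpM2r ?hnorm_ge0.
Qed.

(* For commuting [T = S^n - c] and its adjoint, [|T' x|^2 = <x, T T' x> = <x, T' T x> = |T x|^2]. *)
Lemma normal_iter_norm n (c : C R) x : (forall x, S' (iter n S x) = iter n S (S' x)) ->
  hn (iter n S' x - c^* *: x) = hn (iter n S x - c *: x).
Proof.
move=> comm.
have comm' k y : iter k S' (iter n S y) = iter n S (iter k S' y).
  by elim: k => //= k ->; rewrite comm.
have adj := adjoint_iter n.
have adj' y z : ip (iter n S' y) z = ip y (iter n S z) by rewrite ipC -adj -ipC.
rewrite -[LHS]ger0_norm ?hnorm_ge0// -[RHS]ger0_norm ?hnorm_ge0// -!sqrtr_sqr.
rewrite !sqr_hnorm; congr (Num.sqrt (complex.Re _)).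
rewrite !(ipBl, ipBr, ipZl, ipZr) conjCK !adj !adj' comm'.
ring.
Qed.

End Adjoint.

(** * From vector-valued functions on the plane to scalar functions on a square *)

Section Slices.
Variables (R : realType) (H : lmodType (C R)) (ip : {dot H for Num.conj}).
Local Notation hn := (hnorm ip).
Local Notation normc := ComplexField.Normc.normc.
Local Notation Re := complex.Re.
Local Notation Im := complex.Im.
Local Open Scope classical_set_scope.

Definition translate (z : C R) (x y : R) : C R := z + (x +i* y)%C.

Lemma real_complex_continuous : continuous (fun t : R => (t%:C%C : C R)).
Proof.
move=> a; apply/cvgrPdist_lt => e; case: e => e1 e2; rewrite ltcE /= => /andP[/eqP -> e10].
exists e1 => //= t; rewrite /ball_/= => at_e.
by rewrite -rmorphB /= normc_def /= expr0n addr0 sqrtr_sqr ltcR.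
Qed.

Lemma translateE z x y : translate z x y = z + (x%:C%C + 'i%C * y%:C%C).
Proof. by rewrite /translate [(x +i* y)%C]complexE. Qed.

Lemma translate_continuous z : continuous (fun p : R * R => translate z p.1 p.2).
Proof.
move=> p; rewrite /continuous_at; under eq_fun do rewrite translateE; rewrite translateE.
apply: cvgD; first exact: cvg_cst.
apply: cvgD.
  apply: (@continuous_comp (R * R)%type R (C R) fst (fun t : R => (t%:C%C : C R))).
    exact: cvg_fst.
  exact: real_complex_continuous.
apply: cvgM; first exact: cvg_cst.
apply: (@continuous_comp (R * R)%type R (C R) snd (fun t : R => (t%:C%C : C R))).
  exact: cvg_snd.
exact: real_complex_continuous.
Qed.

Lemma translate0 z : translate z 0 0 = z.
Proof. by rewrite /translate addr0. Qed.

Lemma translate_translate z x y x' y' :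
  translate (translate z x y) x' y' = translate z (x + x') (y + y').
Proof. by rewrite /translate -addrA. Qed.

Lemma nbhs_translate z (P : set (C R)) : nbhs z P ->
  exists2 r : R, 0 < r & forall x y, `|x| < r -> `|y| < r -> P (translate z x y).
Proof.
move=> zP; have := @translate_continuous z (0, 0).
rewrite /continuous_at /= translate0 => /(_ _ zP)[[A1 A2] /= [[r1 /= r10 H1] [r2 /= r20 H2]] HP].
exists (Num.min r1 r2); first by rewrite lt_min r10 r20.
move=> x y; rewrite !lt_min => /andP[xr _] /andP[_ yr].
by apply: (HP (x, y)); split; [apply: H1|apply: H2]; rewrite /= sub0r normrN.
Qed.

Lemma translate_nbhs z (P : set (C R)) r : 0 < r ->
  (forall x y, `|x| <= r -> `|y| <= r -> P (translate z x y)) -> nbhs z P.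
Proof.
move=> r0 HP; exists r%:C%C; first by rewrite /= (ltcR 0).
move=> w; rewrite /ball_/= => zw.
have nzw : normc (w - z) < r by rewrite -ltcR -normcN opprB.
have -> : w = translate z (Re (w - z)) (Im (w - z)).
  rewrite /translate; apply/eqP; rewrite addrC -subr_eq; apply/eqP.
  by case: (w - z).
apply: HP; apply: le_trans (ltW nzw); first exact: normc_Re.
by case: (w - z) => a b /=; rewrite -sqrtr_sqr ler_wsqrtr// lerDr sqr_ge0.
Qed.

Lemma compact_square z r : compact [set w | exists x y, [/\ `|x| <= r, `|y| <= r & w = translate z x y]].
Proof.
have -> : [set w | exists x y, [/\ `|x| <= r, `|y| <= r & w = translate z x y]] =
    (fun p : R * R => translate z p.1 p.2) @` (`[- r, r] `*` `[- r, r]).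
  apply/seteqP; split => w /=.
    by move=> [x [y [xr yr ->]]]; exists (x, y) => //=; split; rewrite /= in_segmentN.
  move=> [[x y] [/= + +] <-]; rewrite !in_segmentN => xr yr.
  by exists x, y.
apply: continuous_compact; first by apply: continuous_subspaceT; exact: translate_continuous.
by apply: compact_setX; exact: segment_compact.
Qed.

Definition hcontinuous_at (f : C R -> H) (z : C R) :=
  forall e : R, 0 < e -> \forall w \near z, hn (f w - f z) <= e.

Section Functional.
Variables (L : H -> R) (c : R).
Hypotheses (LB : forall x y, L (x - y) = L x - L y)
  (LZ : forall (t : R) x, L (t%:C%C *: x) = t * L x) (Lc : forall x, `|L x| <= c * hn x).

Let L_small e x : 0 < e -> hn x <= e / (`|c| + 1) -> `|L x| <= e.
Proof.
move=> e0; rewrite ler_pdivlMr ?ltr_wpDl// => hx.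
apply: le_trans (Lc x) _; apply: le_trans _ hx.
rewrite mulrC ler_wpM2l ?hnorm_ge0//; apply: le_trans (ler_norm _) _.
by rewrite lerDl.
Qed.

Lemma functional_continuous f z a b : hcontinuous_at f (translate z a b) ->
  {for (a, b), continuous (fun p : R * R => L (f (translate z p.1 p.2)))}.
Proof.
move=> cf; apply/cvgrPdist_le => e e0.
have e1 : 0 < e / (`|c| + 1) by rewrite divr_gt0// ltr_wpDl.
have near_ab := @translate_continuous z (a, b) _ (cf _ e1).
apply: (@filterS _ (nbhs ((a, b) : R * R)%type) _ _ _ _ near_ab) => p /= hp; rewrite -LB; apply: L_small => //.
by rewrite -hnormN opprB.
Qed.

Lemma functional_is_derive f d z v (g : R -> R) (a : R) : pderiv_at ip f d z v ->
  (forall t, g (a + t) = L (f (z + t%:C%C * d))) -> is_derive a 1 g (L v).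
Proof.
move=> df gE.
have cv : (fun h => h^-1 *: ((g \o shift a) (h *: (1 : R)) - g a)) @ 0^' --> L v.
  apply/cvgrPdist_le => e e0 /=.
  have e1 : 0 < e / (`|c| + 1) by rewrite divr_gt0// ltr_wpDl.
  have := df _ e1; apply: filterS => h /(L_small e0).
  rewrite -fmorphV LB LZ LB -gE.
  have -> : f z = f (z + (0 : R)%:C%C * d) by rewrite mul0r addr0.
  by rewrite -gE addr0 distrC /shift /GRing.scale /= mulr1 [h + a]addrC.
by apply: DeriveDef; [exact: cvgP cv|exact: cvg_lim].
Qed.

End Functional.

(** [u l] is the [l]-th d-bar derivative of [u 0]; [p b l] is the partial derivative of [u l] in
    direction [dir R b]. *)
Definition dbar_chain (U : set (C R)) (u : nat -> C R -> H) :=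
  exists p : bool -> nat -> C R -> H,
  [/\ forall b l z, U z -> pderiv_at ip (u l) (dir R b) z (p b l z),
      forall l z, U z -> hcontinuous_at (u l) z,
      forall b l z, U z -> hcontinuous_at (p b l) z &
      forall l z, U z -> u l.+1 z = 2^-1 *: (p false l z + 'i%C *: p true l z)].

(** To be used with [L] the real or imaginary part of the pairing with a fixed vector; this keeps
    all integration scalar. *)
Lemma functional_C1 (L : H -> R) (c : R) U z (rho : R) f (p : bool -> C R -> H) :
  (forall x y, L (x - y) = L x - L y) -> (forall (t : R) x, L (t%:C%C *: x) = t * L x) ->
  (forall x, `|L x| <= c * hn x) ->
  (forall x y, `|x| < rho -> `|y| < rho -> U (translate z x y)) ->
  (forall b w, U w -> pderiv_at ip f (dir R b) w (p b w)) ->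
  (forall w, U w -> hcontinuous_at f w) -> (forall b w, U w -> hcontinuous_at (p b) w) ->
  C1_on_square rho (fun x y => L (f (translate z x y)))
    (fun x y => L (p false (translate z x y))) (fun x y => L (p true (translate z x y))).
Proof.
move=> LB LZ Lc sqU df cf cp; split.
- by move=> a b ar br; apply: (functional_continuous LB Lc); apply: cf; exact: sqU.
- by move=> a b ar br; apply: (functional_continuous LB Lc); apply: cp; exact: sqU.
- by move=> a b ar br; apply: (functional_continuous LB Lc); apply: cp; exact: sqU.
- move=> a b ar br; apply: (functional_is_derive LB LZ Lc (df false _ (sqU _ _ ar br))) => t.
  congr (L (f _)); rewrite /translate -addrA; congr (_ + _).
  by apply/eqP; rewrite eq_complex /= !mulr1 !mulr0 subr0 !addr0 !eqxx.
- move=> a b ar br; apply: (functional_is_derive LB LZ Lc (df true _ (sqU _ _ ar br))) => t.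
  congr (L (f _)); rewrite /translate -addrA; congr (_ + _).
  by apply/eqP; rewrite eq_complex /= !mulr1 !mulr0 subr0 !addr0 !eqxx.
Qed.

Lemma dbar_chain_has_dbar U u z (rho : R) l w : dbar_chain U u ->
  (forall x y, `|x| < rho -> `|y| < rho -> U (translate z x y)) ->
  has_dbar rho (fun x y => ip (u l (translate z x y)) w)
    (fun x y => ip (u l.+1 (translate z x y)) w).
Proof.
move=> [p [df cf cp uS]] sqU.
have hw := hnorm_ge0 ip w.
exists (fun x y => ip (p false l (translate z x y)) w),
  (fun x y => ip (p true l (translate z x y)) w); split.
  apply: (@functional_C1 (fun v => Re (ip v w)) (hn w) U z rho (u l) (fun b => p b l)) => //.
  + by move=> x y; rewrite ipBl; case: (ip x w) (ip y w) => [? ?] [].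
  + by move=> t x; rewrite ipZl complex_ReM /= mul0r subr0.
  + by move=> x; apply: le_trans (normc_Re _) _; rewrite mulrC; exact: cauchy_schwarz.
  + by move=> b v; exact: df.
  + exact: cf.
  + by move=> b v; exact: cp.
  apply: (@functional_C1 (fun v => Im (ip v w)) (hn w) U z rho (u l) (fun b => p b l)) => //.
  + by move=> x y; rewrite ipBl; case: (ip x w) (ip y w) => [? ?] [].
  + by move=> t x; rewrite ipZl complex_ImM /= mul0r addr0.
  + move=> x; rewrite mulrC; apply: le_trans (cauchy_schwarz _ _ _).
    by case: (ip x w) => a b /=; rewrite -sqrtr_sqr ler_wsqrtr// lerDr sqr_ge0.
  + by move=> b v; exact: df.
  + exact: cf.
  + by move=> b v; exact: cp.
- by move=> x y xr yr; rewrite (uS _ _ (sqU _ _ xr yr)) ipZl ipDl ipZl.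
Qed.

End Slices.

(** * The a priori estimate for roots of normal operators *)

Section BetaForRootsOfNormal.
Variables (R : realType) (H : lmodType (C R)) (ip : {dot H for Num.conj}).
Local Notation hn := (hnorm ip).
Local Notation normc := ComplexField.Normc.normc.
Local Notation Re := complex.Re.
Local Open Scope classical_set_scope.

(** Pairing with the fixed vector [w] moves [N'] onto [w], so d-bar falls only on [u] and on the
    power of [conj z]. By normality the pairings with [p = 0] are at most [eps |w|], and the one
    with [p = n], [l = 0] is [n! |u z|^2] at the centre. *)
Lemma pointwise_estimate n (r : R) (N N' : H -> H) : (0 < n)%N -> 0 < r ->
  is_adjoint ip N' N -> (forall c x, hn (N' x - c^* *: x) = hn (N x - c *: x)) ->
  exists2 D, 0 <= D & forall U u z eps, dbar_chain ip U u ->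
    (forall x y, `|x| < 2 * r -> `|y| < 2 * r -> U (translate z x y)) ->
    (forall l x y, (l <= 2 * n + 2)%N -> `|x| <= r -> `|y| <= r ->
      hn (N (u l (translate z x y)) - translate z x y ^+ n *: u l (translate z x y)) <= eps) ->
    hn (u 0%N z) <= D * eps.
Proof.
move=> n0 r0 adj normal.
have [D D0 HD] := commutator_chain_bound n r0.
have f0 : 0 < n`!%:R :> R by rewrite ltr0n fact_gt0.
exists (D / n`!%:R); first by rewrite divr_ge0// ltW.
move=> U u z eps chain sqU small.
(* The sign cancels that of the [n]-fold commutator [- n!]. *)
pose w := - u 0%N z.
pose zb x y : R[i] := z^* + (x -i* y)%C.
pose th v l x y : R[i] := ip (u l (translate z x y)) v.
(* [b p l] is [<T_p u_l, w>], where [T_0 = N' - conj z ^ n] and [T_p.+1 = [dbar, T_p]]. *)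
pose b p l x y : R[i] := (p == 0%N)%:R * th (N w) l x y + - (n ^_ p)%:R * zb x y ^+ (n - p) * th w l x y.
have zbE x y : zb x y = (translate z x y)^*.
  by rewrite /zb /translate rmorphD.
have dth v l : has_dbar (2 * r) (th v l) (th v l.+1).
  exact: dbar_chain_has_dbar chain sqU.
have dzb : has_dbar (2 * r) zb (fun _ _ => 1).
  have := has_dbarD (has_dbar_cst (2 * r) (z^* : R[i])) (has_dbar_conj (2 * r)).
  by move/has_dbar_eq; apply => x y _ _; rewrite add0r.
have db p l : has_dbar (2 * r) (b p l) (fun x y => b p.+1 l x y + b p l.+1 x y).
  have := has_dbarD (has_dbarM (has_dbar_cst (2 * r) (p == 0%N)%:R) (dth (N w) l))
    (has_dbarM (has_dbarM (has_dbar_cst (2 * r) (- (n ^_ p)%:R)) (has_dbarX (n - p) dzb)) (dth w l)).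
  move/has_dbar_eq; apply => x y _ _.
  rewrite /b /= ffactnSr natrM subnS; ring.
have btop l x y : b n.+1 l x y = 0.
  by rewrite /b ffact_small// oppr0 !mul0r addr0.
have bsmall l x y : (l <= 2 * n + 2)%N -> `|x| <= r -> `|y| <= r ->
    normc (b 0%N l x y) <= eps * hn w.
  move=> ln xr yr; rewrite /b /= ffactn0 subn0 mul1r mulN1r zbE.
  have -> : th (N w) l x y + - (translate z x y)^* ^+ n * th w l x y =
      ip (N' (u l (translate z x y)) - (translate z x y ^+ n)^* *: u l (translate z x y)) w.
    by rewrite ipBl ipZl adj rmorphXn mulNr.
  apply: le_trans (cauchy_schwarz _ _ _) _.
  by rewrite ler_wpM2r ?hnorm_ge0// normal; exact: small.
have := HD b _ db btop bsmall.
have -> : Re (b n 0%N 0 0) = n`!%:R * hn (u 0%N z) ^+ 2.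
  (* Since [n > 0], the part of [b n 0] coming from [N'] is absent. *)
  rewrite /b gtn_eqF// mul0r add0r ffactnn subnn expr0 mulr1 /th translate0 /w.
  rewrite -scaleN1r ipZr rmorphN1 mulN1r mulrNN sqr_hnorm.
  by rewrite -(rmorph_nat (real_complex R)) complex_ReM /= mul0r oppr0 addr0.
rewrite hnormN => main.
have [->|u0] := eqVneq (hn (u 0%N z)) 0.
  rewrite mulr_ge0 ?divr_ge0 ?(ltW f0)//.
  by apply: le_trans (small 0%N 0 0 _ _ _); rewrite ?hnorm_ge0// normr0 ltW.
have hpos : 0 < hn (u 0%N z) by rewrite lt_def u0 hnorm_ge0.
rewrite mulrAC ler_pdivlMr// -(ler_pM2r hpos) [leLHS](_ : _ = n`!%:R * hn (u 0%N z) ^+ 2).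
  by rewrite -mulrA.
by ring.
Qed.

Definition uniformly_null (U : set (C R)) (u : nat -> C R -> H) :=
  forall K, compact K -> K `<=` U -> forall e : R, 0 < e ->
    exists N : nat, forall k, (N <= k)%N -> forall z, K z -> hn (u k z) <= e.

(** * From the estimate for the power to sequences of functions *)

Section Operator.
Variables (S S' : H -> H) (n : nat).
Hypotheses (n_gt0 : (0 < n)%N) (SS' : is_adjoint ip S S') (Sbounded : bounded_op ip S)
  (Snormal : forall x, S' (iter n S x) = iter n S (S' x)).

Let SD := adjoint_additive SS'.
Let SZ := adjoint_scale SS'.
Let SB x y : S (x - y) = S x - S y.
Proof. by rewrite SD -scaleN1r SZ scaleN1r. Qed.

Let Sbound : exists2 M, 0 <= M & forall x, hn (S x) <= M * hn x.
Proof.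
have [M HM] := Sbounded; exists `|M| => // x; apply: le_trans (HM x) _.
by rewrite ler_wpM2r ?hnorm_ge0// ler_norm.
Qed.

(** Induction through [S^(m+1) - z^(m+1) = S (S^m - z^m) + z^m (S - z)]; the constant is uniform for
    [|z| <= B]. *)
Lemma iter_sub_bound (B : R) m : 0 <= B -> exists2 M, 0 <= M &
  forall z v, normc z <= B -> hn (iter m S v - z ^+ m *: v) <= M * hn (S v - z *: v).
Proof.
move=> B0; have [MS MS0 HMS] := Sbound.
elim: m => [|m [M M0 HM]].
  by exists 0 => // z v _; rewrite expr0 scale1r subrr hnorm0 mul0r.
exists (MS * M + B ^+ m); first by rewrite addr_ge0 ?exprn_ge0// mulr_ge0.
move=> z v zB.
have -> : iter m.+1 S v - z ^+ m.+1 *: v =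
    S (iter m S v - z ^+ m *: v) + z ^+ m *: (S v - z *: v).
  by rewrite iterS SB SZ scalerBr scalerA -exprSr addrA subrK.
apply: le_trans (hnormD _ _ _) _; rewrite mulrDl; apply: lerD.
  by apply: le_trans (HMS _) _; rewrite -mulrA ler_wpM2l// HM.
rewrite hnormZ ler_wpM2r ?hnorm_ge0// normcX.
by apply: lerXn2r; rewrite ?nnegrE ?normc_ge0.
Qed.

Lemma dbar_chain_shift U u m : dbar_chain ip U u -> dbar_chain ip U (fun l => u (l + m)%N).
Proof.
move=> [p [dp cu cp uS]]; exists (fun b l => p b (l + m)%N); split.
- by move=> b l z Uz; exact: dp.
- by move=> l z Uz; exact: cu.
- by move=> b l z Uz; exact: cp.
- by move=> l z Uz; rewrite addSn uS.
Qed.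

(** A tail of a chain is a chain, so the estimate for its first term bounds every [u k m]. It is
    applied at all points near a given [z0] with the same constants, and compactness of [K] does the
    rest. *)
Lemma uniformly_null_chain U (u : nat -> nat -> C R -> H) : open U ->
  (forall k, dbar_chain ip U (u k)) ->
  (forall l, uniformly_null U (fun k z => S (u k l z) - z *: u k l z)) ->
  forall m, uniformly_null U (fun k => u k m).
Proof.
move=> oU chain small m K cK KU e e0.
have nearK : \forall k \near \oo, K `<=` [set z | hn (u k m z) <= e].
  move/compact_near_coveringP: cK => /(_ nat \oo (fun k z => hn (u k m z) <= e) _); apply => z0 Kz0.
  have Unbhs : nbhs z0 U by apply: open_nbhs_nbhs; split => //; exact: KU.
  have [r3 r30 sq3] := nbhs_translate Unbhs.
  (* For [z] within [r] of [z0], the square of half-side [2 r] around [z] stays within [3 r < r3] of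
     [z0], and the one of half-side [r] lies in [Q]. *)
  pose r := r3 / 4; have r0 : 0 < r by rewrite /r; lra.
  pose Q := [set w | exists x y, [/\ `|x| <= 2 * r, `|y| <= 2 * r & w = translate z0 x y]].
  have QU : Q `<=` U by move=> w [x [y [xr yr ->]]]; apply: sq3; rewrite /r in xr yr *; lra.
  have cQ : compact Q by exact: compact_square.
  pose B := normc z0 + 4 * r.
  have B0 : 0 <= B by rewrite addr_ge0 ?normc_ge0//; lra.
  have QB w : Q w -> normc w <= B.
    move=> [x [y [xr yr ->]]]; apply: le_trans (normcD _ _) _; rewrite lerD2l.
    by apply: le_trans (normc_ReIm _) _ => /=; lra.
  have [M M0 HM] := iter_sub_bound n B0.
  have normal c x : hn (iter n S' x - c^* *: x) = hn (iter n S x - c *: x).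
    exact: (normal_iter_norm SS').
  have adj : is_adjoint ip (iter n S') (iter n S).
    exact: adjoint_sym (adjoint_iter SS' n).
  have [D D0 HD] := pointwise_estimate n_gt0 r0 adj normal.
  (* Chosen so that [D * (M * e1) <= e]; [D] and [M] may be zero. *)
  pose e1 := e / (D + 1) / (M + 1).
  have e10 : 0 < e1 by rewrite !divr_gt0// ltr_wpDl.
  have [N HN] : exists N, forall k, (N <= k)%N -> forall l, (l <= 2 * n + 2)%N ->
      forall w, Q w -> hn (S (u k (l + m)%N w) - w *: u k (l + m)%N w) <= e1.
    elim: (2 * n + 2)%N => [|j [N1 HN1]].
      have [N HN] := small m Q cQ QU e1 e10; exists N => k Nk l.
      by rewrite leqn0 => /eqP -> w Qw; exact: HN.
    have [N2 HN2] := small (j.+1 + m)%N Q cQ QU e1 e10.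
    exists (maxn N1 N2) => k; rewrite geq_max => /andP[k1 k2] l.
    rewrite leq_eqVlt => /predU1P[-> w Qw|]; first exact: HN2.
    by rewrite ltnS => /(HN1 k k1).
  exists ([set z | exists x y, [/\ `|x| <= r, `|y| <= r & z = translate z0 x y]], [set k | (N <= k)%N]).
    split; last by exists N.
    by apply: (@translate_nbhs _ _ _ r) => // x y xr yr; exists x, y.
  move=> [z k] [/= [x [y [xr yr zE]]] Nk].
  have := HD U (fun l => u k (l + m)%N) z (e / (D + 1)) (dbar_chain_shift m (chain k)) _ _.
  rewrite add0n => main; apply: le_trans (main _ _) _.
  - move=> x' y' xr' yr'; rewrite zE translate_translate; apply: sq3.
      by apply: le_lt_trans (ler_normD _ _) _; rewrite /r in xr yr xr' yr' *; lra.
    by apply: le_lt_trans (ler_normD _ _) _; rewrite /r in xr yr xr' yr' *; lra.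
  - move=> l x' y' ln xr' yr'.
    have Qw : Q (translate z x' y').
      exists (x + x'), (y + y'); split; last by rewrite zE translate_translate.
        by apply: le_trans (ler_normD _ _) _; lra.
      by apply: le_trans (ler_normD _ _) _; lra.
    apply: le_trans (HM _ _ (QB _ Qw)) _.
    apply: (@le_trans _ _ (M * e1)); first by rewrite ler_wpM2l//; exact: HN.
    rewrite /e1 mulrA ler_pdivrMr ?ltr_wpDl// mulrC ler_wpM2l//; last by lra.
    by rewrite divr_ge0// ?(ltW e0)//; lra.
  - rewrite mulrA ler_pdivrMr ?ltr_wpDl// mulrC ler_wpM2l ?(ltW e0)//; lra.
have [N _ HN] := nearK.
by exists N => k Nk z Kz; exact: (HN k Nk z Kz).
Qed.

End Operator.
End BetaForRootsOfNormal.

(** * Derivatives of all orders *)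

Section Words.
Variables (R : realType) (V : lmodType (C R)).
Implicit Types (Phi Psi : seq bool -> V) (s p : seq bool).

(* The lower-order part of the Leibniz rule for [z *: f z]: sum over the ways of deleting one letter. *)
Fixpoint deletion_sum Phi s : V :=
  if s is b :: s' then dir R b *: Phi s' + deletion_sum (fun p => Phi (b :: p)) s' else 0.

(** The [l]-th power of [(d/dx + i d/dy) / 2] expanded over words. The letter split off is the
    outermost derivative, as in a derivative family. *)
Fixpoint dbar_word Phi l : V :=
  if l is l'.+1 then 2^-1 *: (dbar_word (fun p => Phi (false :: p)) l' +
                              'i%C *: dbar_word (fun p => Phi (true :: p)) l')
  else Phi [::].

Lemma dbar_wordD Phi Psi l :
  dbar_word (fun p => Phi p + Psi p) l = dbar_word Phi l + dbar_word Psi l.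
Proof.
by elim: l Phi Psi => //= l IH Phi Psi; rewrite !IH !scalerDr addrACA.
Qed.

Lemma dbar_wordZ a Phi l : dbar_word (fun p => a *: Phi p) l = a *: dbar_word Phi l.
Proof.
elim: l Phi => //= l IH Phi; rewrite !IH [RHS]scalerA [a * _]mulrC -scalerA; congr (_ *: _).
by rewrite scalerDr !scalerA [a * _]mulrC.
Qed.

Lemma dbar_wordN Phi l : dbar_word (fun p => - Phi p) l = - dbar_word Phi l.
Proof.
under eq_fun do rewrite -scaleN1r; by rewrite dbar_wordZ scaleN1r.
Qed.

Lemma dbar_word0 l : dbar_word (fun=> 0) l = 0.
Proof. by elim: l => //= l ->; rewrite scaler0 addr0 scaler0. Qed.

(* The function [z] is annihilated by d-bar. *)
Lemma dbar_word_deletion Phi l : dbar_word (deletion_sum Phi) l = 0.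
Proof.
elim: l Phi => //= l IH Phi; rewrite !dbar_wordD !IH !addr0 !dbar_wordZ scale1r scalerA.
by rewrite -expr2 sqr_i scaleN1r subrr scaler0.
Qed.

Lemma deletion_sum_cat Phi p s : deletion_sum Phi (p ++ s) =
  deletion_sum (fun q => Phi (q ++ s)) p + deletion_sum (fun t => Phi (p ++ t)) s.
Proof. by elim: p Phi => [|b p IH] Phi /=; rewrite ?add0r// IH addrA. Qed.

Lemma dbar_word_deletion_sum (Phi : seq bool -> seq bool -> V) l s :
  dbar_word (fun p => deletion_sum (Phi p) s) l =
  deletion_sum (fun t => dbar_word (fun p => Phi p t) l) s.
Proof.
elim: s Phi => [|b s IH] Phi /=; first exact: dbar_word0.
by rewrite dbar_wordD dbar_wordZ IH.
Qed.

End Words.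

(** * Smooth families, null sequences and the induction on words *)

Section PropertyBeta.
Variables (R : realType) (H : lmodType (C R)) (ip : {dot H for Num.conj}).
Local Notation hn := (hnorm ip).
Local Notation normc := ComplexField.Normc.normc.
Local Notation hcont := (hcontinuous_at ip).
Local Notation null := (uniformly_null ip).
Local Open Scope classical_set_scope.

Let nearS (z : C R) (P Q : set (C R)) : P `<=` Q -> nbhs z P -> nbhs z Q.
Proof. exact: filterS. Qed.

Let nearI (z : C R) (P Q : set (C R)) : nbhs z P -> nbhs z Q -> nbhs z (P `&` Q).
Proof. exact: filterI. Qed.

Let dnearS (P Q : set R) : P `<=` Q -> nbhs 0^' P -> nbhs (0 : R)^' Q.
Proof. exact: filterS. Qed.

Let dnearI (P Q : set R) : nbhs 0^' P -> nbhs 0^' Q -> nbhs (0 : R)^' (P `&` Q).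
Proof. exact: filterI. Qed.

Let nearA (z : C R) (P : set (C R)) : (forall w, P w) -> nbhs z P.
Proof. by move=> PT; apply: (@nearS z setT) => //; exact: filterT. Qed.

Let dnearA (P : set R) : (forall t, P t) -> nbhs (0 : R)^' P.
Proof. by move=> PT; apply: (@dnearS setT) => //; exact: filterT. Qed.

Section Closure.
Variable z : C R.

Implicit Types f g : C R -> H.

Lemma hcontinuousD f g : hcont f z -> hcont g z -> hcont (fun w => f w + g w) z.
Proof.
move=> cf cg e e0; have e2 : 0 < e / 2 by lra.
have := nearI (cf _ e2) (cg _ e2); apply: nearS => w [h1 h2].
rewrite opprD addrACA; apply: le_trans (hnormD _ _ _) _; lra.
Qed.

Lemma hcontinuousZ a f : hcont f z -> hcont (fun w => a *: f w) z.
Proof.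
move=> cf e e0; have D0 : 0 < normc a + 1 by rewrite ltr_wpDl ?normc_ge0.
have := cf (e / (normc a + 1)); rewrite divr_gt0// => /(_ isT).
apply: nearS => w; rewrite -scalerBr hnormZ ler_pdivlMr// mulrC mulrDl mul1r.
by have := hnorm_ge0 ip (f w - f z); lra.
Qed.

Lemma hcontinuousN f : hcont f z -> hcont (fun w => - f w) z.
Proof. by move=> /(hcontinuousZ (-1)); under eq_fun do rewrite scaleN1r. Qed.

Lemma hcontinuous_cst v : hcont (fun=> v) z.
Proof. by move=> e e0; apply: nearA => w; rewrite subrr hnorm0 ltW. Qed.

Lemma pderivD f g d v w : pderiv_at ip f d z v -> pderiv_at ip g d z w ->
  pderiv_at ip (fun x => f x + g x) d z (v + w).
Proof.
move=> df dg e e0; have e2 : 0 < e / 2 by lra.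
have := dnearI (df _ e2) (dg _ e2); apply: dnearS => t [h1 h2].
rewrite opprD addrACA scalerDr opprD addrACA; apply: le_trans (hnormD _ _ _) _; lra.
Qed.

Lemma pderivZ a f d v : pderiv_at ip f d z v -> pderiv_at ip (fun x => a *: f x) d z (a *: v).
Proof.
move=> df e e0; have D0 : 0 < normc a + 1 by rewrite ltr_wpDl ?normc_ge0.
have := df (e / (normc a + 1)); rewrite divr_gt0// => /(_ isT).
apply: dnearS => t; rewrite -scalerBr scalerA [_ * a]mulrC -scalerA -scalerBr hnormZ.
rewrite ler_pdivlMr// mulrC mulrDl mul1r.
by have := hnorm_ge0 ip ((t%:C%C : C R)^-1 *: (f (z + t%:C%C * d) - f z) - v); lra.
Qed.

Lemma pderivN f d v : pderiv_at ip f d z v -> pderiv_at ip (fun x => - f x) d z (- v).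
Proof. by move=> /(pderivZ (-1)); rewrite scaleN1r; under eq_fun do rewrite scaleN1r. Qed.

Lemma pderiv_cst (v : H) d : pderiv_at ip (fun=> v) d z 0.
Proof. by move=> e e0; apply: dnearA => t; rewrite subrr scaler0 subrr hnorm0 ltW. Qed.

Lemma hcontinuous_mul f : hcont f z -> hcont (fun w => w *: f w) z.
Proof.
move=> cf e e0.
have B0 : 0 < normc z + 1 by rewrite ltr_wpDl ?normc_ge0.
have F0 : 0 < hn (f z) + 1 by rewrite ltr_wpDl ?hnorm_ge0.
have e1 : 0 < e / 2 / (normc z + 1) by rewrite !divr_gt0.
pose r := Num.min 1 (e / 2 / (hn (f z) + 1)).
have r0 : 0 < r by rewrite lt_min ltr01 !divr_gt0.
have nearz : \forall w \near z, normc (w - z) <= r.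
  exists r%:C%C; first by rewrite /= (ltcR 0).
  by move=> w; rewrite /ball_/= => zw; rewrite -lecR -normcN opprB; exact: ltW.
have := nearI (cf _ e1) nearz; apply: nearS => w [h1].
rewrite le_min => /andP[h2 h3].
have -> : w *: f w - z *: f z = w *: (f w - f z) + (w - z) *: f z.
  by rewrite scalerBr scalerBl addrA subrK.
apply: le_trans (hnormD _ _ _) _; rewrite !hnormZ.
have nw : normc w <= normc z + 1.
  by rewrite -[w](subrK z) addrC; apply: le_trans (normcD _ _) _; rewrite lerD2l.
have p1 : normc w * hn (f w - f z) <= e / 2.
  apply: (@le_trans _ _ ((normc z + 1) * (e / 2 / (normc z + 1)))).
    by apply: ler_pM; rewrite ?normc_ge0 ?hnorm_ge0.
  by rewrite mulrC divfK// gt_eqF.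
have p2 : normc (w - z) * hn (f z) <= e / 2.
  apply: (@le_trans _ _ (e / 2 / (hn (f z) + 1) * (hn (f z) + 1))).
    by apply: ler_pM; rewrite ?normc_ge0 ?hnorm_ge0// lerDl.
  by rewrite divfK// gt_eqF.
lra.
Qed.

Lemma hcontinuous_along f d : hcont f z -> forall e : R, 0 < e ->
  \forall t \near (0 : R)^', hn (f (z + (t%:C%C : C R) * d) - f z) <= e.
Proof.
move=> cf e e0; apply: nbhs_dnbhs.
have ct : (fun t : R => z + (t%:C%C : C R) * d) @ (0 : R) --> z + ((0 : R)%:C%C : C R) * d.
  apply: cvgD; first exact: cvg_cst.
  by apply: cvgM; [exact: real_complex_continuous|exact: cvg_cst].
by rewrite mul0r addr0 in ct; exact: (ct _ (cf _ e0)).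
Qed.

(** With [w = z + t d], the error of the difference quotient is exactly [d (f w - f z)] plus [z]
    times the error for [f]; the former needs continuity of [f]. *)
Lemma pderiv_mul f d v : hcont f z -> pderiv_at ip f d z v ->
  pderiv_at ip (fun w => w *: f w) d z (d *: f z + z *: v).
Proof.
move=> cf df e e0.
have Z0 : 0 < normc z + 1 by rewrite ltr_wpDl ?normc_ge0.
have d0 : 0 < normc d + 1 by rewrite ltr_wpDl ?normc_ge0.
have e1 : 0 < e / 2 / (normc z + 1) by rewrite !divr_gt0.
have e2 : 0 < e / 2 / (normc d + 1) by rewrite !divr_gt0.
have t0 : \forall t \near (0 : R)^', t != 0 by exact: nbhs_dnbhs_neq.
have := dnearI t0 (dnearI (df _ e1) (hcontinuous_along d cf e2)).
apply: dnearS => t [tn0 [h1 h2]].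
set w := z + _ in h1 h2 *; set q := _ - v in h1.
have -> : ((t%:C%C : C R)^-1 *: (w *: f w - z *: f z)) - (d *: f z + z *: v) =
    d *: (f w - f z) + z *: q.
  have tC : (t%:C%C : C R) != 0 by rewrite -(rmorph0 (real_complex R)) (inj_eq (@complexI R)).
  have -> : w *: f w - z *: f z = t%:C%C *: (d *: f w) + z *: (f w - f z).
    by rewrite /w scalerDl scalerBr scalerA addrAC addrC addrA.
  rewrite /q scalerDr scalerA mulVf// scale1r !scalerBr !scalerA [z * _]mulrC.
  by rewrite opprD addrACA addrAC addrA.
apply: le_trans (hnormD _ _ _) _; rewrite !hnormZ.
have p1 : normc z * hn q <= e / 2.
  apply: (@le_trans _ _ ((normc z + 1) * (e / 2 / (normc z + 1)))).
    by apply: ler_pM; rewrite ?normc_ge0 ?hnorm_ge0// lerDl.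
  by rewrite mulrC divfK// gt_eqF.
have p2 : normc d * hn (f w - f z) <= e / 2.
  apply: (@le_trans _ _ ((normc d + 1) * (e / 2 / (normc d + 1)))).
    by apply: ler_pM; rewrite ?normc_ge0 ?hnorm_ge0// lerDl.
  by rewrite mulrC divfK// gt_eqF.
lra.
Qed.

Lemma hcontinuous_deletion (G : seq bool -> C R -> H) s : (forall w, hcont (G w) z) ->
  hcont (fun x => deletion_sum (fun w => G w x) s) z.
Proof.
elim: s G => [|b s IH] G cG /=; first exact: hcontinuous_cst.
by apply: hcontinuousD; [exact: hcontinuousZ|exact: (IH (fun w => G (b :: w)))].
Qed.

Lemma pderiv_deletion (G : seq bool -> C R -> H) (G' : seq bool -> H) d s :
  (forall w, pderiv_at ip (G w) d z (G' w)) ->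
  pderiv_at ip (fun x => deletion_sum (fun w => G w x) s) d z (deletion_sum G' s).
Proof.
elim: s G G' => [|b s IH] G G' dG /=; first exact: pderiv_cst.
apply: pderivD; first exact: pderivZ.
exact: (IH (fun w => G (b :: w)) (fun w => G' (b :: w))).
Qed.

Lemma hcontinuous_dbar_word (G : seq bool -> C R -> H) l : (forall w, hcont (G w) z) ->
  hcont (fun x => dbar_word (fun w => G w x) l) z.
Proof.
elim: l G => [|l IH] G cG /=; first exact: cG.
apply/hcontinuousZ/hcontinuousD; first exact: (IH (fun w => G (false :: w))).
by apply: hcontinuousZ; exact: (IH (fun w => G (true :: w))).
Qed.

Lemma pderiv_dbar_word (G : seq bool -> C R -> H) (G' : seq bool -> H) d l :
  (forall w, pderiv_at ip (G w) d z (G' w)) ->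
  pderiv_at ip (fun x => dbar_word (fun w => G w x) l) d z (dbar_word G' l).
Proof.
elim: l G G' => [|l IH] G G' dG /=; first exact: dG.
apply/pderivZ/pderivD; first exact: (IH (fun w => G (false :: w)) (fun w => G' (false :: w))).
by apply: pderivZ; exact: (IH (fun w => G (true :: w)) (fun w => G' (true :: w))).
Qed.

End Closure.

Section NullSequences.
Variable U : set (C R).
Implicit Types u v : nat -> C R -> H.

Lemma nullD u v : null U u -> null U v -> null U (fun k z => u k z + v k z).
Proof.
move=> nu nv K cK KU e e0; have e2 : 0 < e / 2 by lra.
have [N1 H1] := nu K cK KU _ e2; have [N2 H2] := nv K cK KU _ e2.
exists (maxn N1 N2) => k; rewrite geq_max => /andP[k1 k2] z Kz.
apply: le_trans (hnormD _ _ _) _; have := H1 k k1 z Kz; have := H2 k k2 z Kz; lra.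
Qed.

Lemma nullZ a u : null U u -> null U (fun k z => a *: u k z).
Proof.
move=> nu K cK KU e e0; have D0 : 0 < normc a + 1 by rewrite ltr_wpDl ?normc_ge0.
have := nu K cK KU (e / (normc a + 1)); rewrite divr_gt0// => /(_ isT)[N HN].
exists N => k Nk z Kz; have := HN k Nk z Kz.
rewrite hnormZ ler_pdivlMr// mulrC mulrDl mul1r.
by have := hnorm_ge0 ip (u k z); lra.
Qed.

Lemma null0 : null U (fun _ _ => 0).
Proof. by move=> K _ _ e e0; exists 0%N => k _ z _; rewrite hnorm0 ltW. Qed.

Lemma null_dbar_word (Phi : nat -> C R -> seq bool -> H) l :
  (forall p, null U (fun k z => Phi k z p)) -> null U (fun k z => dbar_word (Phi k z) l).
Proof.
elim: l Phi => [|l IH] Phi nPhi /=; first exact: nPhi.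
apply/nullZ/nullD; first exact: (IH (fun k z p => Phi k z (false :: p))).
by apply: nullZ; exact: (IH (fun k z p => Phi k z (true :: p))).
Qed.

(** A deletion shortens the word, so the induction hypothesis on shorter words suffices. *)
Lemma null_deletion (Phi : nat -> C R -> seq bool -> H) s :
  (forall t, (size t < size s)%N -> null U (fun k z => Phi k z t)) ->
  null U (fun k z => deletion_sum (Phi k z) s).
Proof.
elim: s Phi => [|b s IH] Phi nPhi /=; first exact: null0.
apply: nullD; first by apply/nullZ/nPhi.
by apply: (IH (fun k z p => Phi k z (b :: p))) => t ts; exact: nPhi.
Qed.

End NullSequences.

Section Main.
Variables (S S' : H -> H) (n : nat).
Hypotheses (n_gt0 : (0 < n)%N) (SS' : is_adjoint ip S S') (Sbounded : bounded_op ip S)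
  (Snormal : forall x, S' (iter n S x) = iter n S (S' x)).

Let SD := adjoint_additive SS'.
Let SZ := adjoint_scale SS'.
Let SB x y : S (x - y) = S x - S y.
Proof. by rewrite SD -scaleN1r SZ scaleN1r. Qed.

Let Sbound : exists2 M, 0 < M & forall x, hn (S x) <= M * hn x.
Proof.
have [M HM] := Sbounded; exists (`|M| + 1); first by rewrite ltr_wpDl.
move=> x; apply: le_trans (HM x) _; rewrite ler_wpM2r ?hnorm_ge0//.
by apply: le_trans (ler_norm _) _; rewrite lerDl.
Qed.

Lemma hcontinuous_op f z : hcont f z -> hcont (fun w => S (f w)) z.
Proof.
move=> cf e e0; have [M M0 HM] := Sbound.
have := cf (e / M); rewrite divr_gt0// => /(_ isT).
apply: nearS => w; rewrite -SB ler_pdivlMr// mulrC; exact: le_trans.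
Qed.

Lemma pderiv_op f d z v : pderiv_at ip f d z v -> pderiv_at ip (fun w => S (f w)) d z (S v).
Proof.
move=> df e e0; have [M M0 HM] := Sbound.
have := df (e / M); rewrite divr_gt0// => /(_ isT).
apply: dnearS => t; rewrite -SB -SZ -SB ler_pdivlMr// mulrC; exact: le_trans.
Qed.

(** The derivative of [(S - z) f] along [s]: since [z] is affine in the real coordinates, the
    Leibniz rule deletes at most one letter. *)
Definition shifted_family (G : seq bool -> C R -> H) s (z : C R) :=
  S (G s z) - z *: G s z - deletion_sum (fun w => G w z) s.

Lemma shifted_family_deriv U f G : deriv_family ip U f G ->
  deriv_family ip U (fun z => S (f z) - z *: f z) (shifted_family G).
Proof.
move=> [Gf dG cG]; split.
- by move=> z Uz; rewrite /shifted_family /= subr0 Gf.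
(* The new deletion term [dir R b *: G s z] is grouped with [z *: G (b :: s) z] to form the
   derivative of [z *: G s z]. *)
- move=> s b z Uz; rewrite /shifted_family /= opprD addrA -[_ - _ - dir R b *: _]addrA -opprD.
  rewrite [z *: _ + _]addrC.
  apply: pderivD.
    apply: pderivD; first by apply: pderiv_op; exact: dG.
    by apply: pderivN; apply: pderiv_mul; [exact: cG|exact: dG].
  by apply: pderivN; apply: (@pderiv_deletion z G (fun w => G (b :: w) z)) => w; exact: dG.
- move=> s z Uz; apply: hcontinuousD.
    apply: hcontinuousD; first by apply: hcontinuous_op; exact: cG.
    by apply: hcontinuousN; apply: hcontinuous_mul; exact: cG.
  by apply: hcontinuousN; apply: hcontinuous_deletion => w; exact: cG.
Qed.

(** Deletions inside the d-bar prefix cancel, since [z] is holomorphic. Only deletions in [s] are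
    left: shorter words, still with [l] d-bar derivatives. This is why the induction on [s] carries
    all [l] at once. *)
Lemma shifted_family_dbar (G : seq bool -> C R -> H) s l z :
  S (dbar_word (fun p => G (p ++ s) z) l) - z *: dbar_word (fun p => G (p ++ s) z) l =
  dbar_word (fun p => shifted_family G (p ++ s) z) l +
  deletion_sum (fun t => dbar_word (fun p => G (p ++ t) z) l) s.
Proof.
have Sw (Phi : seq bool -> H) : dbar_word (fun p => S (Phi p)) l = S (dbar_word Phi l).
  by elim: l Phi => //= l IH Phi; rewrite !IH -SZ -SD -SZ.
have -> : (fun p => shifted_family G (p ++ s) z) = (fun p => S (G (p ++ s) z) +
    - (z *: G (p ++ s) z) + - (deletion_sum (fun q => G (q ++ s) z) p +
    deletion_sum (fun t => G (p ++ t) z) s)).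
  by apply/funext => p; rewrite /shifted_family deletion_sum_cat.
rewrite !dbar_wordD !dbar_wordN dbar_wordZ dbar_wordD Sw dbar_word_deletion add0r.
by rewrite dbar_word_deletion_sum subrK.
Qed.

Lemma beta_eps_of_normal_power : beta_eps ip S.
Proof.
(* The argument works on every open set, so one neighbourhood serves all [lam]. *)
move=> lam; exists setT; split; first exact: filterT.
move=> U oU _ F _ hyp G dG.
have Lnull s : null U (fun k z => shifted_family (G k) s z).
  move=> K cK KU e e0.
  by apply: (hyp (fun k => shifted_family (G k))) => // k; exact: shifted_family_deriv.
(* Strengthened to all d-bar derivatives of the derivative along [s], as the estimate consumes
   [2 n + 2] of them; the goal is [l = 0]. *)
suff key s l : null U (fun k z => dbar_word (fun p => G k (p ++ s) z) l).
  by move=> s K cK KU e e0; exact: (key s 0%N).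
have [m] := ubnP (size s); elim: m s l => // m IH s l sm.
pose u k l z := dbar_word (fun p => G k (p ++ s) z) l.
apply: (uniformly_null_chain n_gt0 SS' Sbounded Snormal (u := u) oU).
  move=> k; have [_ dGk cGk] := dG k.
  exists (fun b l z => dbar_word (fun p => G k (b :: p ++ s) z) l); split.
  - move=> b i z Uz.
    apply: (@pderiv_dbar_word z (fun p => G k (p ++ s)) (fun p => G k (b :: p ++ s) z)) => w.
    exact: dGk.
  - move=> i z Uz; apply: (@hcontinuous_dbar_word z (fun p => G k (p ++ s))) => w.
    exact: cGk.
  - move=> b i z Uz; apply: (@hcontinuous_dbar_word z (fun p => G k (b :: p ++ s))) => w.
    exact: cGk.
  - by [].
move=> i; rewrite /u.
under eq_fun do under eq_fun do rewrite shifted_family_dbar.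
apply: nullD; first by apply: null_dbar_word => p; exact: Lnull.
apply: null_deletion => t ts; apply: IH.
exact: leq_trans ts sm.
Qed.

End Main.
End PropertyBeta.

Theorem theorem3p6 (R : realType) (H : lmodType (C R))
  (ip : {dot H for Num.conj})
  (Hcomplete : ip_complete ip) (Hinf : infinite_dim H)
  (n : nat) (Hn : (1 < n)%N)
  (A : {linear H -> H}) (HA : bounded_op ip A)
  (Aadj : H -> H) (HAadj : is_adjoint ip A Aadj)
  (Hnormal : forall x : H, Aadj (iter n A x) = iter n A (Aadj x)) :
  beta_eps ip A /\ beta_eps ip Aadj.
Proof.
have adj' : is_adjoint ip Aadj A := adjoint_sym HAadj.
(* The adjoint of the commutation relation, so that [Aadj] satisfies the same hypotheses as [A]. *)
have comm' x : A (iter n Aadj x) = iter n Aadj (A x).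
  apply: (@ip_eq _ _ ip) => y.
  by rewrite HAadj (adjoint_iter adj') -Hnormal -HAadj -(adjoint_iter adj').
split; first exact: (beta_eps_of_normal_power (ltnW Hn) HAadj HA Hnormal).
exact: (beta_eps_of_normal_power (ltnW Hn) adj' (adjoint_bounded HAadj HA) comm').
Qed.
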